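(* Let $\mathcal{C}$ be an Ab4* category, let $n\geq 1$, and let $\{A_i\}_{i\in I}$ be a set of objects of $\mathcal{C}$. Consider the product $\prod_{i\in I}A_i$ with its canonical projections $\pi_i:\prod_{i\in I}A_i\to A_i$ ($i\in I$). Then, for every object $B$ of $\mathcal{C}$, the correspondence $$\Phi_n:\operatorname{Ext}^n_{\mathcal{C}}\Big(B,\prod_{i\in I}A_i\Big)\to\prod_{i\in I}\operatorname{Ext}^n_{\mathcal{C}}(B,A_i),\qquad E\mapsto(\pi_iE)_{i\in I},$$ is an isomorphism of abelian groups, where $\operatorname{Ext}^n_{\mathcal{C}}$ denotes the Yoneda Ext.
   Context: No existence of enough projectives or injectives is assumed. An Ab3* category is an abelian category in which every set-indexed family of objects has a product. An Ab4* category is an Ab3* category in which, for every set of epimorphisms $\{f_i:X_i\to Y_i\}_{i\in I}$, the morphism $\prod_{i\in I}f_i$ is an epimorphism. Yoneda Ext. Let $\mathcal{C}$ be an abelian category and $n\ge 1$. $\mathcal{E}^n_{\mathcal{C}}(C,A)$ is the class of exact sequences $\eta:\ 0\to A\to B_{n-1}\to\cdots\to B_0\to C\to 0$ in $\mathcal{C}$. A morphism of such sequences with fixed ends is a commutative ladder which is $1_A$ on $A$ and $1_C$ on $C$. Let $\equiv$ be the equivalence relation generated by: $\eta\preceq\eta'$ if there is a morphism $\eta\to\eta'$ with fixed ends. Then $\operatorname{Ext}^n_{\mathcal{C}}(C,A):=\mathcal{E}^n_{\mathcal{C}}(C,A)/\equiv$; the class of $\eta$ is denoted $\overline{\eta}$.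 $\operatorname{Ext}^n_{\mathcal{C}}(C,A)$ may be a proper class rather than a set; functions and group structures are understood in this possibly large sense. Actions: for $E=\overline{\eta}\in\operatorname{Ext}^n_{\mathcal{C}}(C,A)$ and $\gamma:C'\to C$, $E\gamma\in\operatorname{Ext}^n_{\mathcal{C}}(C',A)$ is the class of the sequence obtained from $\eta$ by replacing $B_0\to C$ with its pullback along $\gamma$; for $\alpha:A\to A'$, $\alpha E\in\operatorname{Ext}^n_{\mathcal{C}}(C,A')$ is the class of the sequence obtained by replacing $A\to B_{n-1}$ with its pushout along $\alpha$ (these are well defined on classes). Sum: $E+E':=\nabla_A(E\oplus E')\Delta_C$, where $E\oplus E'$ is the class of the termwise direct sum, $\nabla_A=(1_A\ 1_A):A\oplus A\to A$ and $\Delta_C=\binom{1_C}{1_C}:C\to C\oplus C$. With this Baer sum $\operatorname{Ext}^n_{\mathcal{C}}(C,A)$ is an abelian group; products of such groups carry the componentwise structure. *)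

(* Defs.v *)
From HB Require Import structures.
From Stdlib Require Import Relations.
From mathcomp Require Import all_boot ssralg.
From mathcomp Require Import boolp classical_sets.
Set Implicit Arguments.
Unset Strict Implicit.
Unset Printing Implicit Defensive.
Import GRing.Theory.
Local Open Scope ring_scope.

Record preadditive := Preadditive {
  Ob :> Type;
  Mor : Ob -> Ob -> zmodType;
  idm : forall X, Mor X X;
  mcomp : forall X Y Z, Mor Y Z -> Mor X Y -> Mor X Z;
  mcomp1m : forall X Y (f : Mor X Y), mcomp (idm Y) f = f;
  mcompm1 : forall X Y (f : Mor X Y), mcomp f (idm X) = f;
  mcompA : forall X Y Z T (h : Mor Z T) (g : Mor Y Z) (f : Mor X Y),
    mcomp h (mcomp g f) = mcomp (mcomp h g) f;
  mcompDl : forall X Y Z (g g' : Mor Y Z) (f : Mor X Y),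
    mcomp (g + g') f = mcomp g f + mcomp g' f;
  mcompDr : forall X Y Z (g : Mor Y Z) (f f' : Mor X Y),
    mcomp g (f + f') = mcomp g f + mcomp g f' }.

Arguments Mor {C} X Y : rename.
Arguments idm {C} X : rename.
Arguments mcomp {C X Y Z} g f : rename.
Notation "g ∘ f" := (mcomp g f) (at level 40, left associativity).

Section Notions.
Context (C : preadditive).
Implicit Types X Y Z : C.

Definition is_zero Z :=
  (forall X, exists! f : Mor Z X, True) /\ (forall X, exists! f : Mor X Z, True).

Definition mono X Y (f : Mor X Y) :=
  forall T (s t : Mor T X), f ∘ s = f ∘ t -> s = t.

Definition epi X Y (f : Mor X Y) :=
  forall T (s t : Mor Y T), s ∘ f = t ∘ f -> s = t.

Definition is_kernel X Y (f : Mor X Y) K (k : Mor K X) :=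
  f ∘ k = 0 /\ forall T (t : Mor T X), f ∘ t = 0 -> exists! s, k ∘ s = t.

Definition is_cokernel X Y (f : Mor X Y) Q (q : Mor Y Q) :=
  q ∘ f = 0 /\ forall T (t : Mor Y T), t ∘ f = 0 -> exists! s, s ∘ q = t.

Definition is_biproduct X Y S
    (i1 : Mor X S) (i2 : Mor Y S) (p1 : Mor S X) (p2 : Mor S Y) :=
  [/\ p1 ∘ i1 = idm X, p2 ∘ i2 = idm Y, p1 ∘ i2 = 0, p2 ∘ i1 = 0
    & i1 ∘ p1 + i2 ∘ p2 = idm S].

Definition is_product (I : Type) (F : I -> C) P (pi : forall i, Mor P (F i)) :=
  forall T (t : forall i, Mor T (F i)), exists! s, forall i, pi i ∘ s = t i.

Definition is_image X Y (f : Mor X Y) J (k : Mor J Y) :=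
  exists Q (q : Mor Y Q), is_cokernel f q /\ is_kernel q k.

Definition exact X Y Z (f : Mor X Y) (g : Mor Y Z) :=
  exists J (k : Mor J Y), is_image f k /\ is_kernel g k.

Record pullback X Y Z (f : Mor X Z) (g : Mor Y Z) := Pullback {
  pb_ob : C;
  pb1 : Mor pb_ob X;
  pb2 : Mor pb_ob Y;
  pbC : f ∘ pb1 = g ∘ pb2;
  pbU : forall T (s : Mor T X) (t : Mor T Y), f ∘ s = g ∘ t ->
    exists! h, pb1 ∘ h = s /\ pb2 ∘ h = t }.

Record pushout X Y Z (f : Mor Z X) (g : Mor Z Y) := Pushout {
  po_ob : C;
  po1 : Mor X po_ob;
  po2 : Mor Y po_ob;
  poC : po1 ∘ f = po2 ∘ g;
  poU : forall T (s : Mor X T) (t : Mor Y T), s ∘ f = t ∘ g ->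
    exists! h, h ∘ po1 = s /\ h ∘ po2 = t }.

End Notions.

Record abelian := Abelian {
  precat :> preadditive;
  zero_ex : exists Z : precat, is_zero Z;
  biproduct_ex : forall X Y : precat, exists S
    (i1 : Mor X S) (i2 : Mor Y S) (p1 : Mor S X) (p2 : Mor S Y),
    is_biproduct i1 i2 p1 p2;
  kernel_ex : forall (X Y : precat) (f : Mor X Y),
    exists K (k : Mor K X), is_kernel f k;
  cokernel_ex : forall (X Y : precat) (f : Mor X Y),
    exists Q (q : Mor Y Q), is_cokernel f q;
  mono_normal : forall (X Y : precat) (f : Mor X Y), mono f ->
    exists Z (g : Mor Y Z), is_kernel g f;
  epi_normal : forall (X Y : precat) (f : Mor X Y), epi f ->
    exists Z (g : Mor Z X), is_cokernel g f }.

(* The universe of index sets.  It is not tied to the universe of objects, so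
   that categories with a proper class of objects are included. *)
Definition small := Type.

Definition Ab3star (C : abelian) :=
  forall (I : small) (F : I -> C),
    exists P (pi : forall i, Mor P (F i)), is_product pi.

Definition Ab4star (C : abelian) :=
  Ab3star C /\
  forall (I : small) (X Y : I -> C) (f : forall i, Mor (X i) (Y i))
    PX (pX : forall i, Mor PX (X i)) PY (pY : forall i, Mor PY (Y i)),
    is_product pX -> is_product pY ->
  forall g : Mor PX PY, (forall i, pY i ∘ g = f i ∘ pX i) ->
    (forall i, epi (f i)) -> epi g.

Section Basic.
Context (C : preadditive).
Implicit Types X Y Z T : C.

Lemma mcomp0m X Y Z (f : Mor X Y) : (0 : Mor Y Z) ∘ f = 0.
Proof. by apply: (@addIr _ (0 ∘ f)); rewrite -mcompDl !add0r. Qed.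

Lemma mcompm0 X Y Z (g : Mor Y Z) : g ∘ (0 : Mor X Y) = 0.
Proof. by apply: (@addIr _ (g ∘ 0)); rewrite -mcompDr !add0r. Qed.

Lemma mcompNm X Y Z (g : Mor Y Z) (f : Mor X Y) : (- g) ∘ f = - (g ∘ f).
Proof. by apply: (@addIr _ (g ∘ f)); rewrite -mcompDl !addNr mcomp0m. Qed.

Lemma mcompmN X Y Z (g : Mor Y Z) (f : Mor X Y) : g ∘ (- f) = - (g ∘ f).
Proof. by apply: (@addIr _ (g ∘ f)); rewrite -mcompDr !addNr mcompm0. Qed.

Lemma monoP X Y (f : Mor X Y) :
  mono f <-> forall T (t : Mor T X), f ∘ t = 0 -> t = 0.
Proof.
split=> [fM T t ft0|fM T s t fst]; first by apply: fM; rewrite ft0 mcompm0.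
by apply/eqP; rewrite -subr_eq0; apply/eqP/fM; rewrite mcompDr mcompmN fst
  subrr.
Qed.

Lemma epiP X Y (f : Mor X Y) :
  epi f <-> forall T (t : Mor Y T), t ∘ f = 0 -> t = 0.
Proof.
split=> [fM T t ft0|fM T s t fst]; first by apply: fM; rewrite ft0 mcomp0m.
by apply/eqP; rewrite -subr_eq0; apply/eqP/fM; rewrite mcompDl mcompNm fst
  subrr.
Qed.

Lemma kernel_mono X Y (f : Mor X Y) K (k : Mor K X) : is_kernel f k -> mono k.
Proof.
move=> [fk0 U] T s t kst.
have [|w [_ wU]] := U T (k ∘ t); first by rewrite mcompA fk0 mcomp0m.
by rewrite -(wU s kst) -(wU t erefl).
Qed.

Lemma cokernel_epi X Y (f : Mor X Y) Q (q : Mor Y Q) : is_cokernel f q -> epi q.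
Proof.
move=> [fk0 U] T s t kst.
have [|w [_ wU]] := U T (t ∘ q); first by rewrite -mcompA fk0 mcompm0.
by rewrite -(wU s kst) -(wU t erefl).
Qed.

Lemma epi_comp X Y Z (g : Mor Y Z) (f : Mor X Y) :
  epi g -> epi f -> epi (g ∘ f).
Proof. by move=> gE fE T s t; rewrite !mcompA => /fE/gE. Qed.

Lemma epi1 X : epi (idm X).
Proof. by move=> T s t; rewrite !mcompm1. Qed.

End Basic.

Section Choices.
Context (C : abelian).
Implicit Types X Y Z T : C.

Definition zob : C := projT1 (cid (zero_ex C)).

Lemma to_zob X (f : Mor X zob) : f = 0.
Proof.
have [_ /(_ X)[w [_ wU]]] := projT2 (cid (zero_ex C)).
by rewrite -[RHS](wU 0 I) -[LHS](wU f I).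
Qed.

Lemma from_zob X (f : Mor zob X) : f = 0.
Proof.
have [/(_ X)[w [_ wU]] _] := projT2 (cid (zero_ex C)).
by rewrite -[RHS](wU 0 I) -[LHS](wU f I).
Qed.

Record biproduct X Y := Biproduct {
  bp_ob : C;
  bp_in1 : Mor X bp_ob;
  bp_in2 : Mor Y bp_ob;
  bp_pr1 : Mor bp_ob X;
  bp_pr2 : Mor bp_ob Y;
  bpP : is_biproduct bp_in1 bp_in2 bp_pr1 bp_pr2 }.

Lemma biproduct_inh X Y : exists _ : biproduct X Y, True.
Proof.
by have [S [i1 [i2 [p1 [p2 H]]]]] := biproduct_ex X Y; exists (Biproduct H).
Qed.

Definition biproduct_of X Y : biproduct X Y := projT1 (cid (biproduct_inh X Y)).

Definition oplus X Y : C := bp_ob (biproduct_of X Y).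
Definition in1 X Y : Mor X (oplus X Y) := bp_in1 (biproduct_of X Y).
Definition in2 X Y : Mor Y (oplus X Y) := bp_in2 (biproduct_of X Y).
Definition pr1 X Y : Mor (oplus X Y) X := bp_pr1 (biproduct_of X Y).
Definition pr2 X Y : Mor (oplus X Y) Y := bp_pr2 (biproduct_of X Y).

Definition oplus_map X X' Y Y' (f : Mor X Y) (f' : Mor X' Y') :
    Mor (oplus X X') (oplus Y Y') :=
  in1 Y Y' ∘ f ∘ pr1 X X' + in2 Y Y' ∘ f' ∘ pr2 X X'.

Definition diag X : Mor X (oplus X X) := in1 X X + in2 X X.
Definition codiag X : Mor (oplus X X) X := pr1 X X + pr2 X X.

Lemma pr1in1 X Y : pr1 X Y ∘ in1 X Y = idm X.
Proof. by case: (bpP (biproduct_of X Y)). Qed.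
Lemma pr2in2 X Y : pr2 X Y ∘ in2 X Y = idm Y.
Proof. by case: (bpP (biproduct_of X Y)). Qed.
Lemma pr1in2 X Y : pr1 X Y ∘ in2 X Y = 0.
Proof. by case: (bpP (biproduct_of X Y)). Qed.
Lemma pr2in1 X Y : pr2 X Y ∘ in1 X Y = 0.
Proof. by case: (bpP (biproduct_of X Y)). Qed.
Lemma inpr X Y : in1 X Y ∘ pr1 X Y + in2 X Y ∘ pr2 X Y = idm (oplus X Y).
Proof. by case: (bpP (biproduct_of X Y)). Qed.

Lemma oplus_ext X Y T (s t : Mor T (oplus X Y)) :
  pr1 X Y ∘ s = pr1 X Y ∘ t -> pr2 X Y ∘ s = pr2 X Y ∘ t -> s = t.
Proof.
by move=> e1 e2; rewrite -[s]mcomp1m -[t]mcomp1m -inpr !mcompDl -!mcompA e1 e2.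
Qed.

Lemma oplus_coext X Y T (s t : Mor (oplus X Y) T) :
  s ∘ in1 X Y = t ∘ in1 X Y -> s ∘ in2 X Y = t ∘ in2 X Y -> s = t.
Proof.
by move=> e1 e2; rewrite -[s]mcompm1 -[t]mcompm1 -inpr !mcompDr !mcompA e1 e2.
Qed.

(* Projections and injections simplify against each other, also when they occur
   in the middle of a left-associated composite. *)
Lemma pr1in1A X Y T (f : Mor X T) : f ∘ pr1 X Y ∘ in1 X Y = f.
Proof. by rewrite -mcompA pr1in1 mcompm1. Qed.
Lemma pr2in2A X Y T (f : Mor Y T) : f ∘ pr2 X Y ∘ in2 X Y = f.
Proof. by rewrite -mcompA pr2in2 mcompm1. Qed.
Lemma pr1in2A X Y T (f : Mor X T) : f ∘ pr1 X Y ∘ in2 X Y = 0.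
Proof. by rewrite -mcompA pr1in2 mcompm0. Qed.
Lemma pr2in1A X Y T (f : Mor Y T) : f ∘ pr2 X Y ∘ in1 X Y = 0.
Proof. by rewrite -mcompA pr2in1 mcompm0. Qed.

Definition bpE := (mcomp1m, mcompm1, mcomp0m, mcompm0, addr0, add0r, oppr0,
  mcompNm, mcompmN, mcompDl, mcompDr, mcompA, pr1in1, pr2in2, pr1in2, pr2in1,
  pr1in1A, pr2in2A, pr1in2A, pr2in1A).

Lemma pullback_inh X Y Z (f : Mor X Z) (g : Mor Y Z) :
  exists _ : pullback f g, True.
Proof.
have [K [k kK]] := kernel_ex (f ∘ pr1 X Y - g ∘ pr2 X Y).
have kM := kernel_mono kK; have [k0 kU] := kK.
have e : f ∘ (pr1 X Y ∘ k) = g ∘ (pr2 X Y ∘ k).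
  by apply/eqP; rewrite -subr_eq0 -k0 mcompDl mcompNm !mcompA.
have U T (s : Mor T X) (t : Mor T Y) : f ∘ s = g ∘ t ->
    exists! h, pr1 X Y ∘ k ∘ h = s /\ pr2 X Y ∘ k ∘ h = t.
  move=> fgst; have [|h [kh hU]] := kU T (in1 X Y ∘ s + in2 X Y ∘ t).
    by rewrite !bpE fgst subrr.
  exists h; split=> [|h' [e1 e2]]; first by rewrite -!mcompA kh !bpE.
  apply: hU; apply: oplus_ext; first by rewrite mcompA e1 !bpE.
  by rewrite mcompA e2 !bpE.
by exists (Pullback e U).
Qed.

Lemma pushout_inh X Y Z (f : Mor Z X) (g : Mor Z Y) :
  exists _ : pushout f g, True.
Proof.
have [K [k kK]] := cokernel_ex (in1 X Y ∘ f - in2 X Y ∘ g).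
have kM := cokernel_epi kK; have [k0 kU] := kK.
have e : k ∘ in1 X Y ∘ f = k ∘ in2 X Y ∘ g.
  by apply/eqP; rewrite -subr_eq0 -k0 mcompDr mcompmN !mcompA.
have U T (s : Mor X T) (t : Mor Y T) : s ∘ f = t ∘ g ->
    exists! h, h ∘ (k ∘ in1 X Y) = s /\ h ∘ (k ∘ in2 X Y) = t.
  move=> fgst; have [|h [kh hU]] := kU T (s ∘ pr1 X Y + t ∘ pr2 X Y).
    by rewrite !bpE fgst subrr.
  exists h; split=> [|h' [e1 e2]]; first by rewrite !mcompA kh !bpE.
  apply: hU; apply: oplus_coext; first by rewrite -mcompA e1 !bpE.
  by rewrite -mcompA e2 !bpE.
by exists (Pushout e U).
Qed.

Definition pullback_of X Y Z (f : Mor X Z) (g : Mor Y Z) : pullback f g :=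
  projT1 (cid (pullback_inh f g)).

Definition pushout_of X Y Z (f : Mor Z X) (g : Mor Z Y) : pushout f g :=
  projT1 (cid (pushout_inh f g)).

(* The induced morphism into a pullback (out of a pushout); by convention it is
   0 when the square does not commute. *)
Definition pb_pair X Y Z (f : Mor X Z) (g : Mor Y Z) (S : pullback f g) T
    (s : Mor T X) (t : Mor T Y) : Mor T (pb_ob S) :=
  xget 0 [set h | pb1 S ∘ h = s /\ pb2 S ∘ h = t].

Definition po_copair X Y Z (f : Mor Z X) (g : Mor Z Y) (S : pushout f g) T
    (s : Mor X T) (t : Mor Y T) : Mor (po_ob S) T :=
  xget 0 [set h | h ∘ po1 S = s /\ h ∘ po2 S = t].

Lemma pb_pairP X Y Z (f : Mor X Z) (g : Mor Y Z) (S : pullback f g) T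
    (s : Mor T X) (t : Mor T Y) : f ∘ s = g ∘ t ->
  pb1 S ∘ pb_pair S s t = s /\ pb2 S ∘ pb_pair S s t = t.
Proof.
move=> fgst; rewrite /pb_pair; case: xgetP => [h _ //|N].
by have [h [/N]] := pbU S fgst.
Qed.

Lemma po_copairP X Y Z (f : Mor Z X) (g : Mor Z Y) (S : pushout f g) T
    (s : Mor X T) (t : Mor Y T) : s ∘ f = t ∘ g ->
  po_copair S s t ∘ po1 S = s /\ po_copair S s t ∘ po2 S = t.
Proof.
move=> fgst; rewrite /po_copair; case: xgetP => [h _ //|N].
by have [h [/N]] := poU S fgst.
Qed.

Lemma pb_ext X Y Z (f : Mor X Z) (g : Mor Y Z) (S : pullback f g) T
    (h h' : Mor T (pb_ob S)) :
  pb1 S ∘ h = pb1 S ∘ h' -> pb2 S ∘ h = pb2 S ∘ h' -> h = h'.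
Proof.
move=> e1 e2; have [|w [_ wU]] := @pbU _ _ _ _ _ _ S T (pb1 S ∘ h') (pb2 S ∘ h').
  by rewrite !mcompA pbC.
by rewrite -(wU h) // -(wU h').
Qed.

Lemma po_ext X Y Z (f : Mor Z X) (g : Mor Z Y) (S : pushout f g) T
    (h h' : Mor (po_ob S) T) :
  h ∘ po1 S = h' ∘ po1 S -> h ∘ po2 S = h' ∘ po2 S -> h = h'.
Proof.
move=> e1 e2; have [|w [_ wU]] := @poU _ _ _ _ _ _ S T (h' ∘ po1 S) (h' ∘ po2 S).
  by rewrite -!mcompA poC.
by rewrite -(wU h) // -(wU h').
Qed.

Lemma epi_lift X Z T (f : Mor X Z) (t : Mor T Z) : epi f ->
  exists T' (e : Mor T' T) (s : Mor T' X), epi e /\ f ∘ s = t ∘ e.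
Proof.
move=> fE; pose S := pullback_of f t; exists (pb_ob S), (pb2 S), (pb1 S).
split; last exact: pbC.
have dE : epi (f ∘ pr1 X T - t ∘ pr2 X T).
  move=> W r r'; move/(congr1 (fun h => h ∘ in1 X T)).
  by rewrite !bpE => /fE.
have [K [k [k0 kU]]] := epi_normal dE.
apply/epiP => W r r0.
have [|s [sd _]] := kU W (r ∘ pr2 X T).
  have e : f ∘ (pr1 X T ∘ k) = t ∘ (pr2 X T ∘ k).
    apply/eqP; rewrite -subr_eq0; apply/eqP; rewrite -[RHS]k0.
    by rewrite !bpE.
  have [_ e2] := pb_pairP S e.
  by rewrite -mcompA -e2 mcompA r0 mcomp0m.
have s0 : s = 0.
  apply/(proj1 (epiP f) fE).
  have := congr1 (fun h => h ∘ in1 X T) sd.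
  by rewrite !bpE.
have := congr1 (fun h => h ∘ in2 X T) sd.
by rewrite s0 !bpE.
Qed.

Lemma mono_kernel X Y (m : Mor X Y) Q (q : Mor Y Q) :
  mono m -> is_cokernel m q -> is_kernel q m.
Proof.
move=> mM [qm qU]; split=> // T t qt0.
have [Z [g [gm gU]]] := mono_normal mM.
have [g' [gE _]] := qU _ _ gm.
have [|s [ms sU]] := gU _ t; first by rewrite -gE -mcompA qt0 mcompm0.
by exists s.
Qed.

Lemma exactP X Y Z (u : Mor X Y) (v : Mor Y Z) :
  exact u v <-> v ∘ u = 0 /\ forall T (t : Mor T Y), v ∘ t = 0 ->
    exists T' (e : Mor T' T) (s : Mor T' X), epi e /\ u ∘ s = t ∘ e.
Proof.
split=> [[J [k [[Q [q [[qu qU] kq]]] kv]]]|[vu L]].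
  have kM := kernel_mono kq.
  have [m [mE _]] := (proj2 kq) _ _ qu.
  have mepi : epi m.
    apply/epiP => R r r0.
    have [K [k' kr]] := kernel_ex r.
    have k'M := kernel_mono kr.
    have [m' [m'E _]] := (proj2 kr) _ _ r0.
    have kkM : mono (k ∘ k') by move=> W a b; rewrite -!mcompA => /kM/k'M.
    have [W [g [gk gU]]] := mono_normal kkM.
    have [|h [hq _]] := qU _ g.
      by rewrite -mE -m'E 2!mcompA -(mcompA g) gk mcomp0m.
    have [|l [lE _]] := gU _ k; first by rewrite -hq -mcompA (proj1 kq) mcompm0.
    have e : k' ∘ l = idm J by apply: kM; rewrite mcompA lE mcompm1.
    by rewrite -[r]mcompm1 -e mcompA (proj1 kr) mcomp0m.
  split; first by rewrite -mE mcompA (proj1 kv) mcomp0m.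
  move=> T t vt0; have [s [sE _]] := (proj2 kv) _ _ vt0.
  have [T' [e [s' [eE es]]]] := epi_lift s mepi.
  by exists T', e, s'; split=> //; rewrite -mE -mcompA es mcompA sE.
have [Q [q qc]] := cokernel_ex u; have [K [k kq]] := kernel_ex q.
exists K, k; split; first by exists Q, q.
have [h [hE _]] := (proj2 qc) _ _ vu.
split=> [|T t vt0]; first by rewrite -hE -mcompA (proj1 kq) mcompm0.
apply: (proj2 kq).
have [T' [e [s [eE us]]]] := L T t vt0.
by apply: eE; rewrite -mcompA -us mcompA (proj1 qc) !mcomp0m.
Qed.

Lemma exact_comp0 X Y Z (u : Mor X Y) (v : Mor Y Z) : exact u v -> v ∘ u = 0.
Proof. by case/exactP. Qed.

Lemma exact_elt X Y Z (u : Mor X Y) (v : Mor Y Z) T (t : Mor T Y) :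
  exact u v -> v ∘ t = 0 ->
  exists T' (e : Mor T' T) (s : Mor T' X), epi e /\ u ∘ s = t ∘ e.
Proof. by case/exactP => _; apply. Qed.

Lemma exact0P X Y Z (v : Mor Y Z) : exact (0 : Mor X Y) v <-> mono v.
Proof.
split=> [/exactP[_ L]|/monoP vM].
  apply/monoP => T t /L[T' [e [s [eE]]]]; rewrite mcomp0m => /esym.
  exact: (proj1 (epiP e) eE).
apply/exactP; split=> [|T t /vM ->]; first exact: mcompm0.
by exists T, (idm T), 0; split; [exact: epi1|rewrite mcompm1 mcompm0].
Qed.

Lemma exact0rP X Y Z (u : Mor X Y) : exact u (0 : Mor Y Z) <-> epi u.
Proof.
split=> [/exactP[_ L]|uE].
  have [|T' [e [s [eE us]]]] := L _ (idm Y); first exact: mcomp0m.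
  move: us; rewrite mcomp1m => us T a b; move/(congr1 (fun h => h ∘ s)).
  by rewrite -!mcompA us => /eE.
apply/exactP; split=> [|T t _]; [exact: mcomp0m|exact: epi_lift].
Qed.

End Choices.

Notation "X ⊕ Y" := (oplus X Y) (at level 50, left associativity).

Section Sequences.
Context (C : abelian).
Implicit Types A B D X Y : C.

(* A -> B_(n-1) -> ... -> B_0 -> D, read from A to D. *)
Fixpoint chain (n : nat) A D : Type :=
  if n is m.+1 then {B : C & (Mor A B * chain m B D)%type} else Mor A D.

(* Exactness of X -u-> A -> B_(n-1) -> ... -> B_0 -> D -> 0 at every object but
   X and 0. *)
Fixpoint exact_from n X A D (u : Mor X A) : chain n A D -> Prop :=
  match n return chain n A D -> Prop with
  | 0 => fun c => exact u c /\ exact c (0 : Mor D (zob C))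
  | m.+1 => fun c => exact u (projT2 c).1 /\
                     exact_from (projT2 c).1 (projT2 c).2
  end.

Record exseq n D A := ExSeq {
  exseq_chain :> chain n A D;
  exseqP : exact_from (0 : Mor (zob C) A) exseq_chain }.

(* There is a commutative ladder c -> c' whose components at the ends are f
   and g. *)
Fixpoint ladder n A A' D D' (f : Mor A A') (g : Mor D D') :
    chain n A D -> chain n A' D' -> Prop :=
  match n return chain n A D -> chain n A' D' -> Prop with
  | 0 => fun c c' => c' ∘ f = g ∘ c
  | m.+1 => fun c c' => exists h : Mor (projT1 c) (projT1 c'),
      (projT2 c').1 ∘ f = h ∘ (projT2 c).1 /\
      ladder h g (projT2 c).2 (projT2 c').2
  end.

Definition exseq_le n D A (c c' : exseq n D A) : Prop :=
  ladder (idm A) (idm D) c c'.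

Definition exseq_equiv n D A : exseq n D A -> exseq n D A -> Prop :=
  clos_refl_sym_trans (exseq n D A) (@exseq_le n D A).

Definition chain_copair A A' B (u : Mor A B) (a : Mor A A') (S : pushout u a)
    n D : chain n B D -> chain n (po_ob S) D :=
  match n return chain n B D -> chain n (po_ob S) D with
  | 0 => fun v => po_copair S v 0
  | m.+1 => fun t => existT _ (projT1 t) (po_copair S (projT2 t).1 0,
                                          (projT2 t).2)
  end.

Definition push n A A' D (a : Mor A A') (c : chain n.+1 A D) :
    chain n.+1 A' D :=
  let S := pushout_of (projT2 c).1 a in
  existT _ (po_ob S) (po2 S, chain_copair S (projT2 c).2).

Fixpoint pull n A D D' (g : Mor D' D) : chain n.+1 A D -> chain n.+1 A D' :=
  match n return chain n.+1 A D -> chain n.+1 A D' with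
  | 0 => fun c => let S := pullback_of (projT2 c).2 g in
      existT _ (pb_ob S) (pb_pair S (projT2 c).1 0, pb2 S)
  | m.+1 => fun c =>
      existT _ (projT1 c) ((projT2 c).1, pull g (projT2 c).2)
  end.

Fixpoint dsum n A A' D D' : chain n A D -> chain n A' D' ->
    chain n (A ⊕ A') (D ⊕ D') :=
  match n return chain n A D -> chain n A' D' ->
    chain n (A ⊕ A') (D ⊕ D') with
  | 0 => fun c c' => oplus_map c c'
  | m.+1 => fun c c' => existT _ (projT1 c ⊕ projT1 c')
      (oplus_map (projT2 c).1 (projT2 c').1, dsum (projT2 c).2 (projT2 c').2)
  end.

(* 0 -> 0 -> ... -> D = D, with n.+1 middle terms *)
Fixpoint triv n D : chain n.+1 (zob C) D :=
  match n return chain n.+1 (zob C) D with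
  | 0 => existT _ D (0, idm D)
  | m.+1 => existT _ (zob C) (0, triv m D)
  end.

Lemma exact_from_comp0 n X A D (u : Mor X A) (c : chain n.+1 A D) :
  exact_from u c -> (projT2 c).1 ∘ u = 0.
Proof. by case: c => B [v t] [/exact_comp0]. Qed.

Lemma exact_pull n X A D D' (w : Mor X A) (g : Mor D' D) (c : chain n.+1 A D) :
  exact_from w c -> exact_from w (pull g c).
Proof.
elim: n X A w c => [|n IH] X A w [B [u v]] /=; last by case=> ? /IH.
move=> [wu [uv /exact0rP vE]]; have vu := exact_comp0 uv.
set S := pullback_of v g.
have [e1 e2] : pb1 S ∘ pb_pair S u 0 = u /\ pb2 S ∘ pb_pair S u 0 = 0.
  by apply: pb_pairP; rewrite vu mcompm0.
split; last split.
- apply/exactP; split.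
    apply: (@pb_ext _ _ _ _ _ _ S); rewrite mcompA ?e1 ?e2 ?mcomp0m mcompm0 //.
    exact: exact_comp0 wu.
  move=> T t t0; apply: (exact_elt wu).
  by rewrite -e1 -mcompA t0 mcompm0.
- apply/exactP; split=> // T t t0.
  have [|T' [e [s [eE us]]]] := exact_elt (t := pb1 S ∘ t) uv.
    by rewrite mcompA pbC -mcompA t0 mcompm0.
  exists T', e, s; split=> //; apply: (@pb_ext _ _ _ _ _ _ S).
    by rewrite !mcompA e1.
  by rewrite !mcompA e2 t0 !mcomp0m.
- apply/exactP; split=> [|T t _]; first exact: mcomp0m.
  have [T' [e [s [eE vs]]]] := epi_lift (g ∘ t) vE.
  have [] := @pb_pairP _ _ _ _ _ _ S _ s (t ∘ e); first by rewrite vs mcompA.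
  by move=> _ ?; exists T', e, (pb_pair S s (t ∘ e)).
Qed.

Lemma pushout_mono A A' B (u : Mor A B) (a : Mor A A') (S : pushout u a) :
  mono u -> mono (po2 S).
Proof.
move=> uM; apply/monoP => T t t0.
pose m := in1 B A' ∘ u - in2 B A' ∘ a.
have mM : mono m.
  move=> W r r' /(congr1 (fun h => pr1 B A' ∘ h)).
  by rewrite /m !bpE => /uM.
pose q := po1 S ∘ pr1 B A' + po2 S ∘ pr2 B A'.
have qc : is_cokernel m q.
  split; first by rewrite /m /q !bpE poC subrr.
  move=> W r rm; have [|h [[h1 h2] hU]] := @poU _ _ _ _ _ _ S W
      (r ∘ in1 B A') (r ∘ in2 B A').
    by apply/eqP; rewrite -subr_eq0 -rm /m !bpE.
  exists h; split=> [|h' h'q].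
    by apply: oplus_coext; rewrite /q !bpE ?h1 ?h2.
  by apply: hU; rewrite -h'q /q !bpE.
have [_ /(_ T (in2 B A' ∘ t))] := mono_kernel mM qc.
rewrite /q !bpE t0 => /(_ erefl)[s [ms _]].
have s0 : s = 0.
  apply: uM; rewrite mcompm0.
  have := congr1 (fun h => pr1 B A' ∘ h) ms.
  by rewrite /m !bpE.
have := congr1 (fun h => pr2 B A' ∘ h) ms.
by rewrite s0 !bpE.
Qed.

Lemma exact_po A A' B Y (u : Mor A B) (a : Mor A A') (S : pushout u a)
    (v : Mor B Y) : exact u v -> exact (po2 S) (po_copair S v 0).
Proof.
move=> uv; have [e1 e2] : po_copair S v 0 ∘ po1 S = v /\
    po_copair S v 0 ∘ po2 S = 0.
  by apply: po_copairP; rewrite mcomp0m (exact_comp0 uv).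
apply/exactP; split=> // T t t0.
have qE : epi (po1 S ∘ pr1 B A' + po2 S ∘ pr2 B A').
  move=> W r r' rr; apply: (@po_ext _ _ _ _ _ _ S).
    by move: (congr1 (fun h => h ∘ in1 B A') rr); rewrite !bpE.
  by move: (congr1 (fun h => h ∘ in2 B A') rr); rewrite !bpE.
have [T1 [d [s [dE ds]]]] := epi_lift t qE.
have [|T2 [e [r [eE er]]]] := exact_elt (t := pr1 B A' ∘ s) uv.
  have := congr1 (fun h => po_copair S v 0 ∘ h) ds.
  by rewrite !bpE e1 e2 t0 !bpE.
exists T2, (d ∘ e), (a ∘ r + pr2 B A' ∘ s ∘ e).
split; first exact: epi_comp.
by rewrite !bpE -poC -(mcompA _ u r) er !mcompA -ds !bpE.
Qed.

Lemma exact_po_next A A' B Y Z (u : Mor A B) (a : Mor A A') (S : pushout u a)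
    (v : Mor B Y) (w : Mor Y Z) :
  v ∘ u = 0 -> exact v w -> exact (po_copair S v 0) w.
Proof.
move=> vu vw; have [e1 e2] : po_copair S v 0 ∘ po1 S = v /\
    po_copair S v 0 ∘ po2 S = 0 by apply: po_copairP; rewrite mcomp0m.
apply/exactP; split.
  apply: (@po_ext _ _ _ _ _ _ S); rewrite -mcompA ?e1 ?e2 ?mcompm0 !mcomp0m //.
  exact: exact_comp0 vw.
move=> T t t0; have [T' [e [s [eE es]]]] := exact_elt vw t0.
by exists T', e, (po1 S ∘ s); split=> //; rewrite mcompA e1.
Qed.

Lemma exact_push n A A' D (a : Mor A A') (c : chain n.+1 A D) X X' :
  exact_from (0 : Mor X A) c -> exact_from (0 : Mor X' A') (push a c).
Proof.
case: n c => [|n] [B [u t]] /=.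
  move=> [/exact0P uM [ut tE]]; split; first exact/exact0P/pushout_mono.
  split; first exact: exact_po.
  exact: (exact_po_next _ (exact_comp0 ut)).
case: t => B' [v t] /= [/exact0P uM [uv tE]].
split; first exact/exact0P/pushout_mono.
split; first exact: exact_po.
have vu := exact_comp0 uv.
by case: n t tE => [|n] t /= [vt ?]; split=> //; apply: (exact_po_next _ vu).
Qed.

Lemma exact_oplus X Y Z X' Y' Z' (u : Mor X Y) (v : Mor Y Z)
    (u' : Mor X' Y') (v' : Mor Y' Z') :
  exact u v -> exact u' v' -> exact (oplus_map u u') (oplus_map v v').
Proof.
move=> uv uv'; apply/exactP; split.
  rewrite /oplus_map !bpE -(mcompA _ v u) (exact_comp0 uv).
  by rewrite -(mcompA _ v' u') (exact_comp0 uv') !bpE.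
move=> T t t0.
have [|T1 [e [s [eE es]]]] := exact_elt (t := pr1 Y Y' ∘ t) uv.
  have := congr1 (fun h => pr1 Z Z' ∘ h) t0.
  by rewrite /oplus_map !bpE.
have [|T2 [e' [s' [eE' es']]]] := exact_elt (t := pr2 Y Y' ∘ t ∘ e) uv'.
  have := congr1 (fun h => pr2 Z Z' ∘ h ∘ e) t0.
  by rewrite /oplus_map !bpE.
exists T2, (e ∘ e'), (in1 X X' ∘ s ∘ e' + in2 X X' ∘ s').
split; first exact: epi_comp.
apply: oplus_ext; rewrite /oplus_map !bpE.
  by rewrite es.
by rewrite es'.
Qed.

Lemma oplus_map0 X X' Y Y' : oplus_map (0 : Mor X Y) (0 : Mor X' Y') = 0.
Proof. by rewrite /oplus_map !bpE. Qed.

Lemma exact_dsum n X X' A A' D D' (u : Mor X A) (u' : Mor X' A')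
    (c : chain n A D) (c' : chain n A' D') :
  exact_from u c -> exact_from u' c' ->
  exact_from (oplus_map u u') (dsum c c').
Proof.
elim: n X X' A A' u u' c c' => [|n IH] X X' A A' u u'.
  move=> c c' [uc c0] [uc' c0']; split; first exact: exact_oplus.
  by apply/exact0rP; have := exact_oplus c0 c0'; rewrite oplus_map0 => /exact0rP.
move=> [B [v t]] [B' [v' t']] /= [uv vt] [uv' vt'].
by split; [exact: exact_oplus|exact: IH].
Qed.

Lemma exact_from0 n X X' A D (c : chain n A D) :
  exact_from (0 : Mor X A) c -> exact_from (0 : Mor X' A) c.
Proof.
by case: n c => [|n] c /= [/exact0P ? ?]; split=> //; apply/exact0P.
Qed.

Lemma exact_triv n X D : exact_from (0 : Mor X (zob C)) (triv n D).
Proof.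
elim: n X => [|n IH] X /=; last first.
  split; last exact: IH.
  by apply/exact0P/monoP => T t _; exact: to_zob.
split; last split.
- by apply/exact0P/monoP => T t _; exact: to_zob.
- by apply/exact0P/monoP => T t; rewrite mcomp1m.
- exact/exact0rP/epi1.
Qed.

Definition exseq_push n A A' D (a : Mor A A') (c : exseq n.+1 D A) :
  exseq n.+1 D A' := ExSeq (exact_push a (zob C) (exseqP c)).

Definition exseq_pull n A D D' (g : Mor D' D) (c : exseq n.+1 D A) :
  exseq n.+1 D' A := ExSeq (exact_pull g (exseqP c)).

Lemma exact_dsum0 n A A' D D' (c : exseq n D A) (c' : exseq n D' A') :
  exact_from (0 : Mor (zob C) (A ⊕ A')) (dsum c c').
Proof.
have := exact_dsum (exseqP c) (exseqP c').
by rewrite oplus_map0; apply: exact_from0.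
Qed.

Definition exseq_dsum n A A' D D' (c : exseq n D A) (c' : exseq n D' A') :
  exseq n (D ⊕ D') (A ⊕ A') := ExSeq (exact_dsum0 c c').

Definition exseq_triv n D : exseq n.+1 D (zob C) := ExSeq (exact_triv n _ D).

Lemma ladder_id n A D (c : chain n A D) : ladder (idm A) (idm D) c c.
Proof.
elim: n A c => [|n IH] A c /=; first by rewrite mcomp1m mcompm1.
by exists (idm _); split=> //; rewrite mcomp1m mcompm1.
Qed.

Lemma ladder_comp n A A' A'' D D' D'' (f : Mor A A') (f' : Mor A' A'')
    (g : Mor D D') (g' : Mor D' D'') (c : chain n A D) (c' : chain n A' D')
    (c'' : chain n A'' D'') :
  ladder f g c c' -> ladder f' g' c' c'' -> ladder (f' ∘ f) (g' ∘ g) c c''.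
Proof.
elim: n A A' A'' f f' c c' c'' => [|n IH] A A' A'' f f' c c' c'' /=.
  by move=> e e'; rewrite mcompA e' -mcompA e mcompA.
move=> [h [e L]] [h' [e' L']]; exists (h' ∘ h); split; last exact: IH L L'.
by rewrite mcompA e' -mcompA e mcompA.
Qed.

Lemma ladder_push n A A' D X (a : Mor A A') (c : chain n.+1 A D) :
  exact_from (0 : Mor X A) c -> ladder a (idm D) c (push a c).
Proof.
case: c => B [u t] /= [_ ut]; set S := pushout_of u a.
exists (po1 S); split; first by rewrite poC.
case: n t ut => [|n] t /= [/exact_comp0 tu _]; rewrite ?mcomp1m.
  by have [|->] := @po_copairP _ _ _ _ _ _ S _ t 0; rewrite ?mcomp0m.
exists (idm _); split; last exact: ladder_id.
rewrite mcomp1m.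
by have [|->] := @po_copairP _ _ _ _ _ _ S _ (projT2 t).1 0; rewrite ?mcomp0m.
Qed.

Lemma push_desc n A A' D D' X X' (a : Mor A A') (g : Mor D D')
    (c : chain n.+1 A D) (d : chain n.+1 A' D') :
  exact_from (0 : Mor X A) c -> exact_from (0 : Mor X' A') d ->
  ladder a g c d -> ladder (idm A') g (push a c) d.
Proof.
case: c => B [u t]; case: d => B' [w s] /= [_ ut] [_ ws] [h [e L]].
set S := pushout_of u a.
have [h1 h2] : po_copair S h w ∘ po1 S = h /\ po_copair S h w ∘ po2 S = w.
  by apply: po_copairP.
exists (po_copair S h w); split; first by rewrite h2 mcompm1.
case: n t ut s ws L => [|n] t /= [/exact_comp0 tu _] s [/exact_comp0 sw _] /=.
  move=> sh; have [e1 e2] : po_copair S t 0 ∘ po1 S = t /\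
      po_copair S t 0 ∘ po2 S = 0 by apply: po_copairP; rewrite mcomp0m.
  by apply: (@po_ext _ _ _ _ _ _ S); rewrite -!mcompA ?h1 ?h2 ?e1 ?e2 // mcompm0.
move=> [k [sh L]]; exists k; split=> //.
set t1 := (projT2 t).1; have [e1 e2] : po_copair S t1 0 ∘ po1 S = t1 /\
    po_copair S t1 0 ∘ po2 S = 0 by apply: po_copairP; rewrite mcomp0m.
by apply: (@po_ext _ _ _ _ _ _ S); rewrite -!mcompA ?h1 ?h2 ?e1 ?e2 // mcompm0.
Qed.

Lemma ladder_pull n A D D' X (w : Mor X A) (g : Mor D' D) (c : chain n.+1 A D) :
  exact_from w c -> ladder (idm A) g (pull g c) c.
Proof.
elim: n X A w c => [|n IH] X A w [B [u v]] /=; last first.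
  case=> _ /IH L; exists (idm B); split=> //.
  by rewrite mcomp1m mcompm1.
case=> _ [/exact_comp0 vu _]; set S := pullback_of v g.
exists (pb1 S); split; last exact: pbC.
by have [|-> _] := @pb_pairP _ _ _ _ _ _ S _ u 0; rewrite ?mcompm1 ?mcompm0.
Qed.

Lemma pull_lift n A A' D D' X X' (w : Mor X A) (w' : Mor X' A')
    (a : Mor A A') (g : Mor D D') (c : chain n.+1 A D) (d : chain n.+1 A' D') :
  exact_from w c -> exact_from w' d ->
  ladder a g c d -> ladder a (idm D) c (pull g d).
Proof.
elim: n X X' A A' w w' a c d => [|n IH] X X' A A' w w' a; last first.
  move=> [B [u v]] [B' [u' v']] /= [_ uv] [_ uv'] [h [e L]].
  by exists h; split=> //; apply: IH uv uv' L.
move=> [B [u v]] [B' [u' v']] /= [_ [/exact_comp0 uv _]].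
move=> [_ [/exact_comp0 uv' _]] [h [e L]]; set S := pullback_of v' g.
have [h1 h2] := pb_pairP S L.
have [e1 e2] : pb1 S ∘ pb_pair S u' 0 = u' /\ pb2 S ∘ pb_pair S u' 0 = 0.
  by apply: pb_pairP; rewrite uv' mcompm0.
exists (pb_pair S h v); split; last by rewrite h2 mcomp1m.
by apply: (@pb_ext _ _ _ _ _ _ S); rewrite !mcompA ?h1 ?h2 ?e1 ?e2 // mcomp0m.
Qed.

Lemma ladder_dsum n A A' D D' A1 A1' D1 D1' (f : Mor A A1) (f' : Mor A' A1')
    (g : Mor D D1) (g' : Mor D' D1') (c : chain n A D) (c' : chain n A' D')
    (d : chain n A1 D1) (d' : chain n A1' D1') :
  ladder f g c d -> ladder f' g' c' d' ->
  ladder (oplus_map f f') (oplus_map g g') (dsum c c') (dsum d d').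
Proof.
have sq X X' Y Y' Z Z' W W' (p : Mor X Y) (p' : Mor X' Y') (q : Mor Y W)
    (q' : Mor Y' W') (r : Mor X Z) (r' : Mor X' Z') (s : Mor Z W)
    (s' : Mor Z' W') : q ∘ p = s ∘ r -> q' ∘ p' = s' ∘ r' ->
    oplus_map q q' ∘ oplus_map p p' = oplus_map s s' ∘ oplus_map r r'.
  move=> e e'; rewrite /oplus_map !bpE.
  by rewrite -(mcompA _ q p) -(mcompA _ q' p') e e' !mcompA.
elim: n A A' A1 A1' f f' c c' d d' => [|n IH] A A' A1 A1' f f' c c' d d' /=.
  exact: sq.
move=> [h [e L]] [h' [e' L']].
by exists (oplus_map h h'); split; [exact: sq|exact: IH].
Qed.

Lemma ladder_diag n A D (c : chain n A D) :
  ladder (diag A) (diag D) c (dsum c c).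
Proof.
have sq X Y (f : Mor X Y) : oplus_map f f ∘ diag X = diag Y ∘ f.
  by rewrite /oplus_map /diag !bpE.
elim: n A c => [|n IH] A c /=; first exact: sq.
by exists (diag _); split; [exact: sq|exact: IH].
Qed.

Definition swap X Y : Mor (X ⊕ Y) (Y ⊕ X) :=
  in2 Y X ∘ pr1 X Y + in1 Y X ∘ pr2 X Y.

Lemma ladder_swap n A A' D D' (c : chain n A D) (c' : chain n A' D') :
  ladder (swap A A') (swap D D') (dsum c c') (dsum c' c).
Proof.
have sq X X' Y Y' (f : Mor X Y) (f' : Mor X' Y') :
    oplus_map f' f ∘ swap X X' = swap Y Y' ∘ oplus_map f f'.
  by rewrite /oplus_map /swap !bpE addrC.
elim: n A A' c c' => [|n IH] A A' c c' /=; first exact: sq.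
by exists (swap _ _); split; [exact: sq|exact: IH].
Qed.

Definition assoc X Y Z : Mor (X ⊕ Y ⊕ Z) (X ⊕ (Y ⊕ Z)) :=
  in1 X (Y ⊕ Z) ∘ pr1 X Y ∘ pr1 (X ⊕ Y) Z +
  in2 X (Y ⊕ Z) ∘ (in1 Y Z ∘ pr2 X Y ∘ pr1 (X ⊕ Y) Z +
                   in2 Y Z ∘ pr2 (X ⊕ Y) Z).

Lemma ladder_assoc n A A' A'' D D' D'' (c : chain n A D) (c' : chain n A' D')
    (c'' : chain n A'' D'') :
  ladder (assoc A A' A'') (assoc D D' D'')
    (dsum (dsum c c') c'') (dsum c (dsum c' c'')).
Proof.
have sq X X' X'' Y Y' Y'' (f : Mor X Y) (f' : Mor X' Y') (f'' : Mor X'' Y'') :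
    oplus_map f (oplus_map f' f'') ∘ assoc X X' X'' =
    assoc Y Y' Y'' ∘ oplus_map (oplus_map f f') f''.
  by rewrite /oplus_map /assoc !bpE.
elim: n A A' A'' c c' c'' => [|n IH] A A' A'' c c' c'' /=; first exact: sq.
by exists (assoc _ _ _); split; [exact: sq|exact: IH].
Qed.

Lemma ladder_triv n A D X (w : Mor X A) (c : chain n.+1 A D) :
  exact_from w c -> ladder 0 (idm D) c (triv n D).
Proof.
elim: n X A w c => [|n IH] X A w [B [u v]] /=.
  move=> [_ [/exact_comp0 uv _]]; exists v; split=> //.
  by rewrite mcomp0m uv.
by case=> _ /IH L; exists 0; rewrite !mcomp0m; split.
Qed.

(* Equivalence classes, as predicates on sequences.  Meaningful for n >= 1 only:
   the group structure below lives on Ext n.+1. *)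
Record Ext n D A := ExtClass {
  Ext_mem : exseq n D A -> Prop;
  Ext_memP : exists c, Ext_mem = exseq_equiv c }.

Definition cl n D A (c : exseq n D A) : Ext n D A :=
  @ExtClass n D A (exseq_equiv c) (ex_intro _ c erefl).

Lemma Ext_ext n D A (E E' : Ext n D A) : Ext_mem E = Ext_mem E' -> E = E'.
Proof.
case: E E' => [S P] [S' P'] /= e; subst S'.
by congr ExtClass; exact: Prop_irrelevance.
Qed.

Lemma clP n D A (E : Ext n D A) : exists c, E = cl c.
Proof.
by have [c e] := Ext_memP E; exists c; exact: Ext_ext.
Qed.

Lemma exseq_equiv_refl n D A (c : exseq n D A) : exseq_equiv c c.
Proof. exact: rst_refl. Qed.

Lemma cl_eqP n D A (c c' : exseq n D A) : cl c = cl c' <-> exseq_equiv c c'.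
Proof.
split=> [[e]|cc']; first by rewrite e; exact: exseq_equiv_refl.
suff e : exseq_equiv c = exseq_equiv c'.
  exact: Ext_ext.
apply/funext => d; apply/propext; split=> H.
  exact: rst_trans (rst_sym _ _ _ _ cc') H.
exact: rst_trans cc' H.
Qed.

Definition Ext_repr n D A (E : Ext n D A) : exseq n D A :=
  projT1 (cid (clP E)).

Lemma Ext_reprK n D A (E : Ext n D A) : cl (Ext_repr E) = E.
Proof. by rewrite /Ext_repr; case: cid. Qed.

Definition Ext_push n A A' D (a : Mor A A') (E : Ext n.+1 D A) :
  Ext n.+1 D A' := cl (exseq_push a (Ext_repr E)).

Definition Ext_pull n A D D' (E : Ext n.+1 D A) (g : Mor D' D) :
  Ext n.+1 D' A := cl (exseq_pull g (Ext_repr E)).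

Definition Ext_dsum n A A' D D' (E : Ext n D A) (E' : Ext n D' A') :
  Ext n (D ⊕ D') (A ⊕ A') := cl (exseq_dsum (Ext_repr E) (Ext_repr E')).

Definition Ext_add n D A (E E' : Ext n.+1 D A) : Ext n.+1 D A :=
  Ext_pull (Ext_push (codiag A) (Ext_dsum E E')) (diag D).

Definition Ext_zero n D A : Ext n.+1 D A :=
  Ext_push 0 (cl (exseq_triv n D)).

Definition Ext_opp n D A (E : Ext n.+1 D A) : Ext n.+1 D A :=
  Ext_push (- idm A) E.

Lemma cl_ladder n D A (c c' : exseq n D A) :
  ladder (idm A) (idm D) c c' -> cl c = cl c'.
Proof. by move=> L; apply/cl_eqP/rst_step. Qed.

Lemma equiv_map n n' D A D' A' (F : exseq n D A -> exseq n' D' A') :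
  (forall c c', exseq_le c c' -> exseq_le (F c) (F c')) ->
  forall c c', exseq_equiv c c' -> cl (F c) = cl (F c').
Proof.
move=> FP c c'; elim=> {c c'} //.
- by move=> c c' /FP /cl_ladder.
- by move=> c c' c'' _ -> _ ->.
Qed.

Lemma exseq_push_le n A A' D (a : Mor A A') (c c' : exseq n.+1 D A) :
  exseq_le c c' -> exseq_le (exseq_push a c) (exseq_push a c').
Proof.
move=> L; apply: push_desc (exseqP c) (exseqP (exseq_push a c')) _.
by have := ladder_comp L (ladder_push a (exseqP c')); rewrite mcomp1m mcompm1.
Qed.

Lemma exseq_pull_le n A D D' (g : Mor D' D) (c c' : exseq n.+1 D A) :
  exseq_le c c' -> exseq_le (exseq_pull g c) (exseq_pull g c').
Proof.
move=> L; apply: pull_lift (exseqP (exseq_pull g c)) (exseqP c') _.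
by have := ladder_comp (ladder_pull g (exseqP c)) L; rewrite mcomp1m mcomp1m.
Qed.

Lemma oplus_map1 X Y : oplus_map (idm X) (idm Y) = idm (X ⊕ Y).
Proof. by rewrite /oplus_map !bpE inpr. Qed.

Lemma exseq_dsum_le n A A' D D' (c d : exseq n D A) (c' d' : exseq n D' A') :
  exseq_le c d -> exseq_le c' d' ->
  exseq_le (exseq_dsum c c') (exseq_dsum d d').
Proof.
by move=> L L'; have := ladder_dsum L L'; rewrite !oplus_map1.
Qed.

(* The actions and the direct sum are computed on arbitrary representatives. *)
Lemma Ext_pushE n A A' D (a : Mor A A') (c : exseq n.+1 D A) :
  Ext_push a (cl c) = cl (exseq_push a c).
Proof.
by apply: (equiv_map (@exseq_push_le _ _ _ _ a)); apply/cl_eqP/Ext_reprK.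
Qed.

Lemma Ext_pullE n A D D' (g : Mor D' D) (c : exseq n.+1 D A) :
  Ext_pull (cl c) g = cl (exseq_pull g c).
Proof.
by apply: (equiv_map (@exseq_pull_le _ _ _ _ g)); apply/cl_eqP/Ext_reprK.
Qed.

Lemma Ext_dsumE n A A' D D' (c : exseq n D A) (c' : exseq n D' A') :
  Ext_dsum (cl c) (cl c') = cl (exseq_dsum c c').
Proof.
rewrite /Ext_dsum; set r := Ext_repr (cl c); set r' := Ext_repr (cl c').
transitivity (cl (exseq_dsum c r')).
  apply: (@equiv_map _ _ _ _ _ _ (fun x => exseq_dsum x r')).
    by move=> x x' L; apply: exseq_dsum_le => //; exact: ladder_id.
  by apply/cl_eqP/Ext_reprK.
apply: (@equiv_map _ _ _ _ _ _ (fun x => exseq_dsum c x)).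
  by move=> x x' L; apply: exseq_dsum_le => //; exact: ladder_id.
by apply/cl_eqP/Ext_reprK.
Qed.

Lemma push_pull n A A' D D' (a : Mor A A') (g : Mor D D')
    (c : exseq n.+1 D A) (d : exseq n.+1 D' A') :
  ladder a g c d -> Ext_push a (cl c) = Ext_pull (cl d) g.
Proof.
move=> L; rewrite Ext_pushE Ext_pullE; apply: cl_ladder => /=.
apply: pull_lift (exseqP (exseq_push a c)) (exseqP d) _.
exact: push_desc (exseqP c) (exseqP d) L.
Qed.

Lemma Ext_push1 n A D (E : Ext n.+1 D A) : Ext_push (idm A) E = E.
Proof.
have [c ->] := clP E; rewrite Ext_pushE.
exact/esym/cl_ladder/(ladder_push _ (exseqP c)).
Qed.

Lemma Ext_pull1 n A D (E : Ext n.+1 D A) : Ext_pull E (idm D) = E.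
Proof.
have [c ->] := clP E; rewrite Ext_pullE.
exact/cl_ladder/(ladder_pull _ (exseqP c)).
Qed.

Lemma Ext_push_comp n A A' A'' D (b : Mor A' A'') (a : Mor A A')
    (E : Ext n.+1 D A) : Ext_push b (Ext_push a E) = Ext_push (b ∘ a) E.
Proof.
have [c ->] := clP E; rewrite !Ext_pushE -[LHS]Ext_pull1 -[RHS]Ext_pushE.
apply/esym/push_pull; rewrite -[idm D]mcomp1m.
exact: ladder_comp (ladder_push _ (exseqP c))
  (ladder_push _ (exseqP (exseq_push a c))).
Qed.

Lemma Ext_pull_comp n A D D' D'' (g : Mor D' D) (h : Mor D'' D')
    (E : Ext n.+1 D A) : Ext_pull (Ext_pull E g) h = Ext_pull E (g ∘ h).
Proof.
have [c ->] := clP E; rewrite !Ext_pullE -[LHS]Ext_push1 -[RHS]Ext_pullE.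
apply: push_pull; rewrite -[idm A]mcomp1m.
exact: ladder_comp (ladder_pull _ (exseqP (exseq_pull g c)))
  (ladder_pull _ (exseqP c)).
Qed.

Lemma Ext_pushpull n A A' D D' (a : Mor A A') (g : Mor D' D)
    (E : Ext n.+1 D A) : Ext_push a (Ext_pull E g) = Ext_pull (Ext_push a E) g.
Proof.
have [c ->] := clP E; rewrite Ext_pullE [in RHS]Ext_pushE.
apply: push_pull.
have := ladder_comp (ladder_pull g (exseqP c)) (ladder_push a (exseqP c)).
by rewrite mcompm1 mcomp1m.
Qed.

Lemma Ext_push_dsum n A A' A1 A1' D D' (a : Mor A A1) (a' : Mor A' A1')
    (E : Ext n.+1 D A) (E' : Ext n.+1 D' A') :
  Ext_push (oplus_map a a') (Ext_dsum E E') =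
  Ext_dsum (Ext_push a E) (Ext_push a' E').
Proof.
have [c ->] := clP E; have [c' ->] := clP E'.
rewrite [in RHS]Ext_pushE [in RHS]Ext_pushE !Ext_dsumE -[RHS]Ext_pull1.
apply: push_pull; rewrite -oplus_map1.
by apply: ladder_dsum; apply: ladder_push; apply: exseqP.
Qed.

Lemma Ext_pull_dsum n A A' D D' D1 D1' (g : Mor D1 D) (g' : Mor D1' D')
    (E : Ext n.+1 D A) (E' : Ext n.+1 D' A') :
  Ext_pull (Ext_dsum E E') (oplus_map g g') =
  Ext_dsum (Ext_pull E g) (Ext_pull E' g').
Proof.
have [c ->] := clP E; have [c' ->] := clP E'.
rewrite [in RHS]Ext_pullE [in RHS]Ext_pullE !Ext_dsumE -[RHS]Ext_push1.
apply/esym/push_pull; rewrite -oplus_map1.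
by apply: ladder_dsum; apply: ladder_pull; apply: exseqP.
Qed.

Lemma Ext_addC n D A : commutative (@Ext_add n D A).
Proof.
move=> E E'; rewrite /Ext_add.
have -> : Ext_push (codiag A) (Ext_dsum E E') =
    Ext_push (codiag A ∘ swap A A) (Ext_dsum E E').
  by congr Ext_push; rewrite /codiag /swap !bpE addrC.
have [c ->] := clP E; have [c' ->] := clP E'; rewrite -Ext_push_comp !Ext_dsumE.
rewrite (@push_pull _ _ _ _ _ _ _ (exseq_dsum c c') (exseq_dsum c' c)
  (ladder_swap c c')) Ext_pushpull Ext_pull_comp.
by congr Ext_pull; rewrite /diag /swap !bpE addrC.
Qed.

Lemma Ext_addA n D A : associative (@Ext_add n D A).
Proof.
move=> E1 E2 E3; rewrite /Ext_add.
have e (E : Ext n.+1 D A) : E = Ext_pull (Ext_push (idm A) E) (idm D).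
  by rewrite Ext_pull1 Ext_push1.
rewrite [in LHS](e E1) [in RHS](e E3).
rewrite -!Ext_pull_dsum -!Ext_push_dsum !Ext_pushpull !Ext_pull_comp.
rewrite !Ext_push_comp.
have -> : codiag A ∘ oplus_map (codiag A) (idm A) =
    codiag A ∘ oplus_map (idm A) (codiag A) ∘ assoc A A A.
  by rewrite /codiag /oplus_map /assoc !bpE addrA.
rewrite -[in RHS]Ext_push_comp.
have [c1 ->] := clP E1; have [c2 ->] := clP E2; have [c3 ->] := clP E3.
rewrite !Ext_dsumE (@push_pull _ _ _ _ _ _ _ (exseq_dsum (exseq_dsum c1 c2) c3)
  (exseq_dsum c1 (exseq_dsum c2 c3)) (ladder_assoc c1 c2 c3)) Ext_pushpull.
rewrite Ext_pull_comp; congr Ext_pull.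
by rewrite /diag /oplus_map /assoc !bpE addrA.
Qed.

Lemma Ext_pushDl n A A' D (a b : Mor A A') (E : Ext n.+1 D A) :
  Ext_push (a + b) E = Ext_add (Ext_push a E) (Ext_push b E).
Proof.
have -> : a + b = codiag A' ∘ oplus_map a b ∘ diag A.
  by rewrite /codiag /oplus_map /diag !bpE.
rewrite -!Ext_push_comp /Ext_add -Ext_push_dsum.
have [c ->] := clP E.
by rewrite (@push_pull _ _ _ _ _ _ _ c (exseq_dsum c c) (ladder_diag c))
  !Ext_pushpull Ext_dsumE.
Qed.

Lemma Ext_push0 n A A' D (E : Ext n.+1 D A) :
  Ext_push (0 : Mor A A') E = Ext_zero n D A'.
Proof.
have -> : (0 : Mor A A') = (0 : Mor (zob C) A') ∘ (0 : Mor A (zob C)).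
  by rewrite mcomp0m.
rewrite -Ext_push_comp /Ext_zero; congr Ext_push; have [c ->] := clP E.
rewrite -[RHS]Ext_pull1; apply: push_pull; exact: ladder_triv (exseqP c).
Qed.

Lemma Ext_add0 n D A : left_id (Ext_zero n D A) (@Ext_add n D A).
Proof.
move=> E; rewrite -(Ext_push0 A E) -{2}[E]Ext_push1 -Ext_pushDl add0r.
exact: Ext_push1.
Qed.

Lemma Ext_addN n D A :
  left_inverse (Ext_zero n D A) (@Ext_opp n D A) (@Ext_add n D A).
Proof.
move=> E; rewrite /Ext_opp -{2}[E]Ext_push1 -Ext_pushDl addNr.
exact: Ext_push0.
Qed.

End Sequences.

HB.instance Definition _ (C : abelian) n (D A : C) := gen_eqMixin (Ext n D A).
HB.instance Definition _ (C : abelian) n (D A : C) :=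
  gen_choiceMixin (Ext n D A).
HB.instance Definition _ (C : abelian) n (D A : C) :=
  GRing.isZmodule.Build (Ext n.+1 D A)
    (@Ext_addA C n D A) (@Ext_addC C n D A)
    (@Ext_add0 C n D A) (@Ext_addN C n D A).

Definition dprod (I : Type) (G : I -> zmodType) : Type := forall i, G i.

Section DProd.
Context (I : Type) (G : I -> zmodType).
Implicit Types x y : dprod G.

Definition dprod_zero : dprod G := fun=> 0.
Definition dprod_opp x : dprod G := fun i => - x i.
Definition dprod_add x y : dprod G := fun i => x i + y i.

Lemma dprod_ext x y : (forall i, x i = y i) -> x = y.
Proof. exact: functional_extensionality_dep. Qed.

Lemma dprod_addA : associative dprod_add.
Proof. by move=> x y z; apply: dprod_ext => i; exact: addrA. Qed.
Lemma dprod_addC : commutative dprod_add.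
Proof. by move=> x y; apply: dprod_ext => i; exact: addrC. Qed.
Lemma dprod_add0 : left_id dprod_zero dprod_add.
Proof. by move=> x; apply: dprod_ext => i; exact: add0r. Qed.
Lemma dprod_addN : left_inverse dprod_zero dprod_opp dprod_add.
Proof. by move=> x; apply: dprod_ext => i; exact: addNr. Qed.

HB.instance Definition _ := gen_eqMixin (dprod G).
HB.instance Definition _ := gen_choiceMixin (dprod G).
HB.instance Definition _ := GRing.isZmodule.Build (dprod G)
  dprod_addA dprod_addC dprod_add0 dprod_addN.

End DProd.

Definition Ext_to_prod (C : abelian) n (I : small) (A : I -> C) (P : C)
    (pi : forall i, Mor P (A i)) (B : C) (E : Ext n.+1 B P) :
  dprod (fun i => Ext n.+1 B (A i)) := fun i => Ext_push (pi i) E.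

Arguments Ext_to_prod {C} n {I A P} pi B E.

(* Main.v *)
(* Surjectivity: by Ab4* the product of representatives of classes in
   Ext(B, A_i) is an exact sequence from prod A_i to B^I, and its pullback along
   the diagonal B -> B^I is a preimage.

   Injectivity: the same construction should send equivalent families to
   equivalent sequences, but for infinite I the zigzags realizing the
   equivalences may have unbounded length.  So the equivalence is first shown to
   be realized by zigzags c -> d <- c' of length two, i.e. every span
   c <- x -> c' completes to a cospan c -> y <- c': one takes the termwise
   pushout, after adding contractible summands to c which make x -> c a
   monomorphism in the relevant degrees.  If now pi_i c -> d_i <- pi_i c' for
   all i, then c and c' both map to the pullback of prod d_i along the
   diagonal. *)
Require Import Defs.
From mathcomp Require Import all_boot ssralg.
From mathcomp Require Import boolp.
Set Implicit Arguments.
Unset Strict Implicit.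
Unset Printing Implicit Defensive.
Import GRing.Theory.
Local Open Scope ring_scope.

(** * Completing spans of exact sequences to cospans *)

Section Cospans.
Context (C : abelian).
Implicit Types A B D K X Y Z : C.

Lemma cokernel_exact X Y Q (u : Mor X Y) (q : Mor Y Q) :
  is_cokernel u q -> exact u q.
Proof.
move=> qc; have [K [k kq]] := kernel_ex q.
by exists K, k; split=> //; exists Q, q.
Qed.

Lemma mono_cokernel_exact X Y Q (u : Mor X Y) (q : Mor Y Q) :
  mono u -> is_cokernel u q -> exact u q.
Proof.
move=> uM qc; have qu := mono_kernel uM qc.
by exists X, u; split=> //; exists Q, q.
Qed.

Lemma exact_comp_mono X Y Z W (u : Mor X Y) (q : Mor Y Z) (v : Mor Z W) :
  exact u q -> mono v -> exact u (v ∘ q).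
Proof.
move=> uq /monoP vM; apply/exactP; split.
  by rewrite -mcompA (exact_comp0 uq) mcompm0.
by move=> T t; rewrite -mcompA => /vM; exact: exact_elt.
Qed.

Lemma exact_comp_epi X Y Z W (q : Mor X Y) (v : Mor Y Z) (w : Mor Z W) :
  epi q -> (exact (v ∘ q) w <-> exact v w).
Proof.
move=> qE; split=> vw; apply/exactP; split.
- apply: qE; rewrite mcomp0m -mcompA; exact: exact_comp0 vw.
- move=> T t wt; have [T' [e [s [eE es]]]] := exact_elt vw wt.
  by exists T', e, (q ∘ s); rewrite mcompA.
- by rewrite mcompA (exact_comp0 vw) mcomp0m.
- move=> T t wt; have [T1 [e [s [eE es]]]] := exact_elt vw wt.
  have [T2 [d [r [dE dr]]]] := epi_lift s qE.
  exists T2, (e ∘ d), r; split; first exact: epi_comp.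
  by rewrite -mcompA dr mcompA es mcompA.
Qed.

(** The kernel of [v ∘ q] is the image of [u], which [q] kills; so whatever [v] kills, lifted along
    [q], vanishes. *)
Lemma exact_coker_mono X Y Z Q (u : Mor X Y) (q : Mor Y Q) (v : Mor Q Z) :
  is_cokernel u q -> exact u (v ∘ q) -> mono v.
Proof.
move=> qc uvq; apply/monoP => T t vt.
have [T1 [e [s [eE es]]]] := epi_lift t (cokernel_epi qc).
have [|T2 [d [r [dE dr]]]] := exact_elt (t := s) uvq.
  by rewrite -mcompA es mcompA vt mcomp0m.
apply: (epi_comp eE dE).
by rewrite mcompA -es -mcompA -dr mcompA (proj1 qc) !mcomp0m.
Qed.

(** Serves for splicing: along a cokernel, it turns a sequence starting at that cokernel into the
    tail of a longer one; [exact_from_coker] undoes this. *)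
Definition precomp n A A' D (h : Mor A' A) : chain n A D -> chain n A' D :=
  match n return chain n A D -> chain n A' D with
  | 0 => fun c => c ∘ h
  | m.+1 => fun c => existT _ (projT1 c) ((projT2 c).1 ∘ h, (projT2 c).2)
  end.

Lemma precomp1 n A D (c : chain n A D) : precomp (idm A) c = c.
Proof.
by case: n c => [|n] /= => [c|[B [u c]]]; rewrite /= mcompm1.
Qed.

Lemma ladder_precomp n A A' A1 A1' D D' (q : Mor A' A) (r : Mor A1' A1)
    (h : Mor A' A1') (k : Mor A A1) (g : Mor D D') (c : chain n A D)
    (d : chain n A1 D') :
  k ∘ q = r ∘ h -> ladder k g c d -> ladder h g (precomp q c) (precomp r d).
Proof.
move=> e; case: n c d => [|n] c d /=.
  by move=> L; rewrite -mcompA -e mcompA L mcompA.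
move=> [l [L1 L2]]; exists l; split=> //.
by rewrite -mcompA -e mcompA L1 mcompA.
Qed.

Lemma ladder_precomp_epi n A A' A1 A1' D D' (q : Mor A' A) (r : Mor A1' A1)
    (h : Mor A' A1') (k : Mor A A1) (g : Mor D D') (c : chain n A D)
    (d : chain n A1 D') :
  epi q -> k ∘ q = r ∘ h -> ladder h g (precomp q c) (precomp r d) ->
  ladder k g c d.
Proof.
move=> qE e; case: n c d => [|n] c d /=.
  by move=> L; apply: qE; rewrite -mcompA e mcompA L mcompA.
move=> [l [L1 L2]]; exists l; split=> //.
by apply: qE; rewrite -mcompA e mcompA L1 mcompA.
Qed.

Lemma precomp_exact n X X' A K D (u : Mor X A) (q : Mor A K) (c : chain n K D) :
  exact u q -> epi q -> exact_from (0 : Mor X' K) c ->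
  exact_from u (precomp q c).
Proof.
move=> uq qE; case: n c => [|n] c /= [/exact0P cM c0].
  by split; [exact: exact_comp_mono|apply/(exact_comp_epi _ _ qE)].
split; first exact: exact_comp_mono.
by case: n c cM c0 => [|n] c cM /= [? ?]; split=> //;
  apply/(exact_comp_epi _ _ qE).
Qed.

Lemma exact_from_coker n X A K D X' (u : Mor X A) (q : Mor A K)
    (c : chain n A D) :
  is_cokernel u q -> exact_from u c ->
  exists c' : chain n K D, c = precomp q c' /\ exact_from (0 : Mor X' K) c'.
Proof.
move=> qc; have qE := cokernel_epi qc; case: n c => [|n] c /= [uc c0].
  have [v [vq _]] := proj2 qc _ _ (exact_comp0 uc); subst c.
  exists v; split=> //; split; last exact/(exact_comp_epi _ _ qE).
  by apply/exact0P; exact: exact_coker_mono qc uc.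
case: c uc c0 => B [w t] /= uc c0.
have [v [vq _]] := proj2 qc _ _ (exact_comp0 uc); subst w.
exists (existT _ B (v, t)); split=> //=; split.
  by apply/exact0P; exact: exact_coker_mono qc uc.
by case: n t c0 => [|n] t /= [? ?]; split=> //; apply/(exact_comp_epi _ _ qE).
Qed.

Lemma in1_natural X X' Y Y' (f : Mor X X') (g : Mor Y Y') :
  oplus_map f g ∘ in1 X Y = in1 X' Y' ∘ f.
Proof. by rewrite /oplus_map !bpE. Qed.

Lemma epi_oplus X X' Y Y' (f : Mor X X') (g : Mor Y Y') :
  epi f -> epi g -> epi (oplus_map f g).
Proof.
move=> fE gE T s t e; apply: oplus_coext.
  by apply: fE; rewrite -!mcompA -!(in1_natural f g) !mcompA e.
have n2 : oplus_map f g ∘ in2 X Y = in2 X' Y' ∘ g by rewrite /oplus_map !bpE.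
by apply: gE; rewrite -!mcompA -!n2 !mcompA e.
Qed.

(* The summand added to c is the contractible complex on the first term of x
   (nothing if n = 0, when f is an isomorphism already). *)
Lemma mono_replacement n A A' D X (f : Mor A A') (x : chain n A D)
    (c : chain n A' D) :
  exact_from (0 : Mor X A) x -> exact_from (0 : Mor X A') c ->
  ladder f (idm D) x c ->
  exists Z (j : Mor A Z) (d : chain n (A' ⊕ Z) D),
    [/\ exact_from (0 : Mor X (A' ⊕ Z)) d, ladder (in1 A' Z) (idm D) c d,
        ladder (in1 A' Z ∘ f + in2 A' Z ∘ j) (idm D) x d
      & mono (in1 A' Z ∘ f + in2 A' Z ∘ j)].
Proof.
case: n x c => [|n] x c /=.
  move=> [/exact0P xM _] [/exact0P cM /exact0rP cE] xc.
  exists (zob C), 0, (c ∘ pr1 A' (zob C)); split.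
  - split; last first.
      apply/exact0rP => T s t; rewrite !mcompA => /(congr1 (mcomp^~ (in1 _ _))).
      by rewrite !bpE => /cE.
    apply/exact0P/monoP => T t; rewrite -mcompA => ct.
    apply: oplus_ext; last by rewrite !(to_zob (_ ∘ _)).
    by apply: cM; rewrite ct !mcompm0.
  - by rewrite !bpE.
  - by rewrite !bpE xc !bpE.
  - apply/monoP => T t; rewrite !bpE -!mcompA => /(congr1 (mcomp (pr1 _ _))).
    rewrite !bpE => ft; apply: xM.
    by rewrite mcompm0 -[x]mcomp1m -xc -mcompA ft mcompm0.
case: x c => [B [u s]] [B' [v t]] /= [/exact0P uM us] [/exact0P vM vt].
move=> [h [vf L]].
have n1 : in1 B' B ∘ v = oplus_map v (idm B) ∘ in1 A' B by rewrite in1_natural.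
exists B, u, (existT _ (B' ⊕ B) (oplus_map v (idm B), precomp (pr1 B' B) t)).
split=> /=.
- split.
    apply/exact0P/monoP => T r r0; apply: oplus_ext.
      apply: vM; move/(congr1 (mcomp (pr1 _ _))): r0.
      by rewrite /oplus_map !bpE.
    move/(congr1 (mcomp (pr2 _ _))): r0.
    by rewrite /oplus_map !bpE.
  have pE : epi (pr1 B' B).
    by move=> T r r' /(congr1 (mcomp^~ (in1 _ _))); rewrite !bpE.
  (* Only the first summand of an element killed by [w ∘ pr1] has to be lifted along [v]; the second
     one is its own preimage under the identity. *)
  have ex Y (w : Mor B' Y) :
      exact v w -> exact (oplus_map v (idm B)) (w ∘ pr1 B' B).
    move=> vw; apply/exactP; split.
      by rewrite /oplus_map !bpE (exact_comp0 vw) mcomp0m.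
    move=> T r; rewrite -mcompA => wr.
    have [T' [e [r' [eE er]]]] := exact_elt vw wr.
    exists T', e, (in1 A' B ∘ r' + in2 A' B ∘ (pr2 B' B ∘ r ∘ e)); split=> //.
    by apply: oplus_ext; rewrite /oplus_map !bpE ?er.
  case: n s t us vt L => [|n] s t us /= [vt t0] L.
    by split; [exact: ex|apply/(exact_comp_epi _ _ pE)].
  split; first exact: ex.
  by case: n t t0 vt {s us L} => [|n] t /= [? ?] vt; split=> //;
    apply/(exact_comp_epi _ _ pE).
- exists (in1 B' B); split; first by rewrite in1_natural.
  rewrite -{1}[t]precomp1; apply: ladder_precomp (ladder_id t).
  by rewrite pr1in1 mcomp1m.
- exists (in1 B' B ∘ h + in2 B' B); split.
    by rewrite /oplus_map !bpE -!mcompA vf.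
  rewrite -{1}[s]precomp1; apply: ladder_precomp L.
  by rewrite !bpE.
- apply/monoP => T r /(congr1 (mcomp (pr2 _ _))).
  by rewrite !bpE => ur; apply: uM; rewrite ur mcompm0.
Qed.

(* po2 S ∘ v' can fail to be a monomorphism; it is one when h is, which is why
   mono_replacement is needed. *)
Lemma pushout_cokernel A X K B L B' L' (u : Mor A X) (q : Mor X K)
    (v : Mor A B) (r : Mor B L) (v' : Mor A B') (r' : Mor B' L')
    (h : Mor X B) (h' : Mor X B') (k : Mor K L) (k' : Mor K L')
    (S : pushout h h') (T : pushout k k') (s : Mor (po_ob S) (po_ob T)) :
  epi q -> is_cokernel v r -> is_cokernel v' r' ->
  h ∘ u = v -> h' ∘ u = v' -> k ∘ q = r ∘ h -> k' ∘ q = r' ∘ h' ->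
  s ∘ po1 S = po1 T ∘ r -> s ∘ po2 S = po2 T ∘ r' ->
  is_cokernel (po2 S ∘ v') s.
Proof.
move=> qE rc rc' hu hu' kq kq' s1 s2.
have w1 : po2 S ∘ v' = po1 S ∘ v by rewrite -hu -hu' !mcompA poC.
split=> [|Z m mw].
  by rewrite mcompA s2 -mcompA (proj1 rc') mcompm0.
have [|m1 [m1E _]] := proj2 rc _ (m ∘ po1 S); first by rewrite -mcompA -w1.
have [|m2 [m2E _]] := proj2 rc' _ (m ∘ po2 S); first by rewrite -mcompA.
have [|l [[l1 l2] _]] := @poU _ _ _ _ _ _ T _ m1 m2.
  (* The two descended maps agree on [K] because they agree after the epimorphism [q], where both
     come from [m] on the pushout [S]. *)
  by apply: qE; rewrite -!mcompA kq kq' !mcompA m1E m2E -!mcompA poC.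
have ls : l ∘ s = m.
  by apply: (@po_ext _ _ _ _ _ _ S); rewrite -mcompA ?s1 ?s2 mcompA ?l1 ?l2.
exists l; split=> // l' l's; apply: (@po_ext _ _ _ _ _ _ T).
  by apply: (cokernel_epi rc); rewrite -!mcompA -s1 !mcompA l's ls.
by apply: (cokernel_epi rc'); rewrite -!mcompA -s2 !mcompA l's ls.
Qed.

(** The left ends may differ and are joined by a pushout because the induction cuts off first terms:
    the truncations of sequences with equal left ends start at different cokernels. *)
Definition cospan_extension n := forall A A1 A2 D X
    (f : Mor A A1) (g : Mor A A2) (S : pushout f g)
    (x : chain n A D) (c : chain n A1 D) (d : chain n A2 D),
  exact_from (0 : Mor X A) x -> exact_from (0 : Mor X A1) c ->
  exact_from (0 : Mor X A2) d ->
  ladder f (idm D) x c -> ladder g (idm D) x d ->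
  exists y : chain n (po_ob S) D,
    [/\ exact_from (0 : Mor X (po_ob S)) y, ladder (po1 S) (idm D) c y
      & ladder (po2 S) (idm D) d y].

(** [f] is the kernel of some [g], which is 0 because [f] is epi, so the identity of [Y] factors
    through [f]. *)
Lemma mono_epi_section X Y (f : Mor X Y) :
  mono f -> epi f -> exists g, f ∘ g = idm Y /\ g ∘ f = idm X.
Proof.
move=> fM fE; have [Z [g [gf gU]]] := mono_normal fM.
have g0 : g = 0 by apply: fE; rewrite gf mcomp0m.
have [|s [fs _]] := gU Y (idm Y); first by rewrite g0 mcomp0m.
by exists s; split=> //; apply: fM; rewrite mcompA fs mcomp1m mcompm1.
Qed.

Lemma cospan_extension0 : cospan_extension 0.
Proof.
move=> A A1 A2 D X f g S x c d /= [/exact0P xM /exact0rP xE].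
move=> [/exact0P cM /exact0rP cE] [/exact0P dM /exact0rP dE].
rewrite !mcomp1m => cf dg.
have [|y [[y1 y2] _]] := @poU _ _ _ _ _ _ S _ c d; first by rewrite cf dg.
have [c' [cc' c'c]] := mono_epi_section cM cE.
have [d' [dd' d'd]] := mono_epi_section dM dE.
have [x' [xx' x'x]] := mono_epi_section xM xE.
exists y; split; rewrite ?mcomp1m //; split; last first.
  by apply/exact0rP => T s t; move/(congr1 (mcomp^~ (po1 S)));
     rewrite -!mcompA y1 => /cE.
(* In length 0 all chains are isomorphisms, hence so are [f] and [g]; the inverse of [y] is
   [po1 S ∘ c']. *)
suff e : po1 S ∘ c' ∘ y = idm _.
  apply/exact0P/monoP => T t yt.
  by rewrite -[t]mcomp1m -e -mcompA yt mcompm0.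
apply: (@po_ext _ _ _ _ _ _ S); rewrite -!mcompA ?y1 ?y2 ?c'c mcomp1m.
  by rewrite mcompm1.
have gx : g ∘ x' = d' by apply: dM; rewrite mcompA dg xx' dd'.
have fx : f ∘ x' = c' by apply: cM; rewrite mcompA cf xx' cc'.
by rewrite -[RHS]mcompm1 -d'd -gx !mcompA -poC -fx !mcompA.
Qed.

(** Each sequence is cut at the cokernel of its first morphism. The hypothesis joins the
    truncations, and the result is spliced with the pushout of the first middle terms. *)
Lemma cospan_step n A D X (x c d : chain n.+1 A D) :
  cospan_extension n ->
  exact_from (0 : Mor X A) x -> exact_from (0 : Mor X A) c ->
  exact_from (0 : Mor X A) d ->
  ladder (idm A) (idm D) x c -> ladder (idm A) (idm D) x d ->
  exists y : chain n.+1 A D, [/\ exact_from (0 : Mor X A) y,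
    ladder (idm A) (idm D) c y & ladder (idm A) (idm D) d y].
Proof.
move=> IH; case: x c d => [X1 [u t]] [B [v a]] [B' [v' b]] /=.
move=> [/exact0P uM ut] [/exact0P vM va] [/exact0P v'M v'b].
rewrite !mcompm1 => -[h [hu La]] [h' [hu' Lb]].
have [K [q qc]] := cokernel_ex u; have qE := cokernel_epi qc.
have [L [r rc]] := cokernel_ex v; have rE := cokernel_epi rc.
have [L' [r' rc']] := cokernel_ex v'; have rE' := cokernel_epi rc'.
have [t1 [tE t1x]] := exact_from_coker X qc ut; subst t.
have [a1 [aE a1x]] := exact_from_coker X rc va; subst a.
have [b1 [bE b1x]] := exact_from_coker X rc' v'b; subst b.
have [|k [kq _]] := proj2 qc _ (r ∘ h).
  by rewrite -mcompA -hu (proj1 rc).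
have [|k' [kq' _]] := proj2 qc _ (r' ∘ h').
  by rewrite -mcompA -hu' (proj1 rc').
have {}La := ladder_precomp_epi qE kq La.
have {}Lb := ladder_precomp_epi qE kq' Lb.
(* Adding [Z] to the truncation of [c] makes [K -> L ⊕ Z] mono. Below, [hh], [vv] and [rr] carry the
   same summand back to the first middle term, with [j ∘ q] as the new component of [hh]. *)
have [Z [j [a2 [a2x La12 Lta kM]]]] := mono_replacement t1x a1x La.
set kk := _ + _ in Lta kM.
pose hh := in1 B Z ∘ h + in2 B Z ∘ (j ∘ q).
pose vv := in1 B Z ∘ v; pose rr := oplus_map r (idm Z).
have rrc : is_cokernel vv rr.
  split=> [|T m mv].
    by rewrite /vv mcompA in1_natural -mcompA (proj1 rc) mcompm0.
  have [|l [lE _]] := proj2 rc _ (m ∘ in1 B Z); first by rewrite -mcompA.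
  have rrE : epi rr by apply: epi_oplus rE (@epi1 _ _).
  exists (l ∘ pr1 L Z + m ∘ in2 B Z ∘ pr2 L Z); split=> [|l' l'E].
    by apply: oplus_coext; rewrite /rr /oplus_map !bpE ?lE.
  apply: rrE; rewrite l'E.
  by apply: oplus_coext; rewrite /rr /oplus_map !bpE ?lE.
have kkq : kk ∘ q = rr ∘ hh by rewrite /kk /hh /rr /oplus_map !bpE -!mcompA kq.
have hhu : hh ∘ u = vv.
  by rewrite /hh /vv !bpE -!mcompA -hu (proj1 qc) !mcompm0 addr0.
(* A five lemma argument: [hh z = 0] gives [kk (q z) = 0], so [q z = 0] and [z] comes from [A] up to
   an epimorphism; there [hh] is the monomorphism [vv]. *)
have hhM : mono hh.
  apply/monoP => T z hz.
  have [|T' [e [s [eE es]]]] := exact_elt (t := z) (cokernel_exact qc).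
    by apply: kM; rewrite mcompA kkq -mcompA hz !mcompm0.
  have vvM : mono vv.
    move=> W s1 s2 /(congr1 (mcomp (pr1 _ _))); rewrite /vv !bpE; exact: vM.
  have s0 : s = 0.
    by apply: vvM; rewrite -hhu -mcompA es mcompA hz mcomp0m mcompm0.
  by apply: eE; rewrite -es s0 mcompm0 mcomp0m.
pose S := pushout_of hh h'; pose T := pushout_of kk k'.
have [s1 s2] := @po_copairP _ _ _ _ _ _ S _ (po1 T ∘ rr) (po2 T ∘ r')
   ltac:(by rewrite -!mcompA -kkq -kq' !mcompA poC).
set s := po_copair _ _ _ in s1 s2.
have sc := pushout_cokernel qE rrc rc' hhu (esym hu') kkq kq' s1 s2.
have wM : mono (po2 S ∘ v').
  by move=> W z z'; rewrite -!mcompA => /(pushout_mono hhM) /v'M.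
have [y1 [y1x Lay Lby]] := IH _ _ _ _ _ _ _ T _ _ _ t1x a2x b1x Lta Lb.
exists (existT _ (po_ob S) (po2 S ∘ v', precomp s y1)); split=> /=.
- split; first exact/exact0P.
  exact: precomp_exact (mono_cokernel_exact wM sc) (cokernel_epi sc) y1x.
(* The sequence [c] reaches the pushout through its enlargement by [Z], hence the injection
   [in1 B Z]. *)
- exists (po1 S ∘ in1 B Z); split.
    by rewrite mcompm1 -(mcompA (po1 S)) -/vv -hhu hu' !mcompA poC.
  have := ladder_comp La12 Lay; rewrite mcomp1m; apply: ladder_precomp.
  by rewrite mcompA s1 /rr -!mcompA in1_natural.
- exists (po2 S); split; first by rewrite mcompm1.
  by apply: ladder_precomp Lby; rewrite s2.
Qed.

(** Pushing all three sequences out to the common left end [po_ob S] reduces to [cospan_step]; [x]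
    is pushed along [po1 S ∘ f = po2 S ∘ g]. *)
Lemma cospan_extensionS n : cospan_extension n -> cospan_extension n.+1.
Proof.
move=> IH A A1 A2 D X f g S x c d xx cx dx xc xd.
have Lc := ladder_push (po1 S) cx; have Ld := ladder_push (po2 S) dx.
have xLc := ladder_comp xc Lc; have xLd := ladder_comp xd Ld.
rewrite mcomp1m in xLc; rewrite mcomp1m -poC in xLd.
have {}xLc := push_desc xx (exact_push (po1 S) X cx) xLc.
have {}xLd := push_desc xx (exact_push (po2 S) X dx) xLd.
have [y [yx Lcy Ldy]] := cospan_step IH (exact_push _ X xx)
  (exact_push _ X cx) (exact_push _ X dx) xLc xLd.
exists y; split=> //.
  by have := ladder_comp Lc Lcy; rewrite !mcomp1m.
by have := ladder_comp Ld Ldy; rewrite !mcomp1m.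
Qed.

Lemma cospan_ext n : cospan_extension n.
Proof.
elim: n => [|n IH]; first exact: cospan_extension0.
exact: cospan_extensionS.
Qed.

(** In the transitive case the two cospans share the leg source [d], and the span [y <- d -> z] is
    completed by [cospan_step]. *)
Lemma exseq_equivP n A D (c d : exseq n.+1 D A) :
  exseq_equiv c d -> exists y : exseq n.+1 D A, exseq_le c y /\ exseq_le d y.
Proof.
elim=> {c d} [c d cd|c|c d _ [y [cy dy]]|c d e _ [y [cy dy]] _ [z [dz ez]]].
- by exists d; split=> //; exact: ladder_id.
- by exists c; split; exact: ladder_id.
- by exists y.
- have [w [wx yw zw]] :=
    cospan_step (@cospan_ext n) (exseqP d) (exseqP y) (exseqP z) dy dz.
  exists (ExSeq wx); split.
    by have := ladder_comp cy yw; rewrite !mcomp1m.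
  by have := ladder_comp ez zw; rewrite !mcomp1m.
Qed.

End Cospans.

(** * Products of exact sequences in an Ab4* category *)

Section Products.
Context (C : abelian) (I : Type).

Lemma product_ext (F : I -> C) P (pi : forall i, Mor P (F i)) T
    (s t : Mor T P) :
  is_product pi -> (forall i, pi i ∘ s = pi i ∘ t) -> s = t.
Proof.
by move=> /(_ T (fun i => pi i ∘ t))[w [_ wU]] e; rewrite -(wU s) // -(wU t).
Qed.

Lemma exact_mono_epi (X Y Z : C) (u : Mor X Y) (v : Mor Y Z) :
  exact u v -> exists J (k : Mor J Y) (e : Mor X J),
    [/\ is_kernel v k, epi e & u = k ∘ e].
Proof.
move=> uv; have [J [k kv]] := kernel_ex v.
have [e [eE _]] := proj2 kv _ _ (exact_comp0 uv).
exists J, k, e; split=> //.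
have [T [d [s [dE ds]]]] := exact_elt uv (proj1 kv).
have es : e ∘ s = d by apply: (kernel_mono kv); rewrite mcompA eE.
by move=> W a b /(congr1 (mcomp^~ s)); rewrite -!mcompA es => /dE.
Qed.

(** Each [u i] is an epimorphism onto the kernel of [v i]. Products preserve kernels in any case,
    and Ab4* makes the product of the epimorphisms epi. *)
Lemma product_exact (hC : Ab4star C) (X Y Z : I -> C)
    (u : forall i, Mor (X i) (Y i)) (v : forall i, Mor (Y i) (Z i))
    PX (pX : forall i, Mor PX (X i)) PY (pY : forall i, Mor PY (Y i))
    PZ (pZ : forall i, Mor PZ (Z i)) (u' : Mor PX PY) (v' : Mor PY PZ) :
  is_product pX -> is_product pY -> is_product pZ ->
  (forall i, pY i ∘ u' = u i ∘ pX i) -> (forall i, pZ i ∘ v' = v i ∘ pY i) ->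
  (forall i, exact (u i) (v i)) -> exact u' v'.
Proof.
move=> hX hY hZ uE vE uv.
pose J i := projT1 (cid (exact_mono_epi (uv i))).
pose k i : Mor (J i) (Y i) :=
  projT1 (cid (projT2 (cid (exact_mono_epi (uv i))))).
pose e i : Mor (X i) (J i) :=
  projT1 (cid (projT2 (cid (projT2 (cid (exact_mono_epi (uv i))))))).
have kP i : [/\ is_kernel (v i) (k i), epi (e i) & u i = k i ∘ e i].
  exact: projT2 (cid (projT2 (cid (projT2 (cid (exact_mono_epi (uv i))))))).
have [PJ [pJ hJ]] := proj1 hC I J.
have [e' [eE _]] := hJ _ (fun i => e i ∘ pX i).
have e'E : epi e' by apply: (proj2 hC I X J e _ pX _ pJ) => // i; case: (kP i).
apply/exactP; split.
  apply: (product_ext hZ) => i.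
  by rewrite mcompA vE -mcompA uE mcompA (exact_comp0 (uv i)) mcomp0m mcompm0.
move=> T t t0.
have ex i : exists s, k i ∘ s = pY i ∘ t.
  have [[_ kU] _ _] := kP i; have [|s [sE _]] := kU _ (pY i ∘ t).
    by rewrite mcompA -vE -mcompA t0 mcompm0.
  by exists s.
have [s [sE _]] := hJ T (fun i => projT1 (cid (ex i))).
have [T' [d [r [dE er]]]] := epi_lift s e'E.
exists T', d, r; split=> //; apply: (product_ext hY) => i.
have [_ _ ue] := kP i.
rewrite mcompA uE ue -2!mcompA [in e i ∘ _]mcompA -eE -mcompA er.
by rewrite (mcompA (pJ i)) sE mcompA (projT2 (cid (ex i))) -mcompA.
Qed.

(** A relation rather than a construction, since the middle products are only known to exist. The
    last clause allows any incoming family [w], so that exactness passes along the induction on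
    length. *)
Definition product_chain n (A D : I -> C) P (pi : forall i, Mor P (A i))
    Q (rho : forall i, Mor Q (D i)) (c : forall i, chain n (A i) (D i))
    (p : chain n P Q) : Prop :=
  [/\ forall i, ladder (pi i) (rho i) p (c i),
      forall X Y (x : chain n X Y) (f : Mor X P) (g : Mor Y Q),
        (forall i, ladder (pi i ∘ f) (rho i ∘ g) x (c i)) -> ladder f g x p
    & forall (W : I -> C) V (om : forall i, Mor V (W i))
        (w : forall i, Mor (W i) (A i)) (w' : Mor V P),
        is_product om -> (forall i, pi i ∘ w' = w i ∘ om i) ->
        (forall i, exact_from (w i) (c i)) -> exact_from w' p].

Lemma product_chain_ex (hC : Ab4star C) n (A D : I -> C)
    P (pi : forall i, Mor P (A i)) Q (rho : forall i, Mor Q (D i))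
    (c : forall i, chain n (A i) (D i)) :
  is_product pi -> is_product rho -> exists p, product_chain pi rho c p.
Proof.
move=> + hQ; elim: n A P pi c => [|n IH] A P pi c hP.
  have [p [pE pU]] := hQ _ (fun i => (c i : Mor (A i) (D i)) ∘ pi i).
  exists p; split=> [i|X Y x f g|W V om w w' hV wE wc] /=.
  - by rewrite pE.
  - move=> L; apply: (product_ext hQ) => i.
    by rewrite !mcompA pE -mcompA L.
  - split.
      by apply: (product_exact hC hV hP hQ wE pE) => i; case: (wc i).
    apply/exact0rP; apply: (proj2 hC I A D c _ pi _ rho) => // i.
    by case: (wc i) => _ /exact0rP.
pose B i := projT1 (c i).
have [R [si hR]] := proj1 hC I B.
have [u [uE _]] := hR _ (fun i => (projT2 (c i)).1 ∘ pi i).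
have [p [pL pU pX]] := IH _ _ si (fun i => (projT2 (c i)).2) hR.
exists (existT _ R (u, p)).
split=> [i|X Y [Z [x1 x2]] f g L|W V om w w' hV wE wc] /=.
- by exists (si i); rewrite uE; split=> //; exact: pL.
- pose h i : Mor Z (B i) := projT1 (cid (L i)).
  have hE i : (projT2 (c i)).1 ∘ (pi i ∘ f) = h i ∘ x1 /\
      ladder (h i) (rho i ∘ g) x2 (projT2 (c i)).2 by exact: projT2 (cid (L i)).
  have [l [lE _]] := hR Z h; exists l; split.
    apply: (product_ext hR) => i.
    by rewrite !mcompA uE lE -mcompA (proj1 (hE i)).
  by apply: pU => i; rewrite lE; exact: proj2 (hE i).
- split.
    by apply: (product_exact hC hV hP hR wE uE) => i; case: (wc i).
  by apply: (pX _ _ _ _ _ hP uE) => i; case: (wc i).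
Qed.

Lemma product_exseq (hC : Ab4star C) n (A D : I -> C)
    P (pi : forall i, Mor P (A i)) Q (rho : forall i, Mor Q (D i))
    (c : forall i, exseq n (D i) (A i)) :
  is_product pi -> is_product rho ->
  exists p : exseq n Q P, product_chain pi rho c p.
Proof.
move=> hP hQ; have [p pP] := product_chain_ex hC c hP hQ.
have [_ _ pX] := pP.
(* The zero object is its own [I]-fold power, so the zero maps into the [A i] form a family to which
   the exactness clause applies. *)
have h0 : is_product (fun _ : I => idm (zob C)).
  move=> T t; exists 0; split=> [i|s _]; last exact/esym/to_zob.
  by rewrite mcomp1m; exact/esym/to_zob.
have px : exact_from (0 : Mor (zob C) P) p.
  apply: (pX _ _ _ (fun i => 0) _ h0) => i; last exact: exseqP.
  by rewrite mcompm0 mcomp0m.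
by exists (ExSeq px).
Qed.

End Products.

(** * Additivity of the action of a morphism on Ext *)

Lemma Ext_push_add (C : abelian) n (A A' D : C) (a : Mor A A')
    (E E' : Ext n.+1 D A) :
  Ext_push a (Ext_add E E') = Ext_add (Ext_push a E) (Ext_push a E').
Proof.
rewrite /Ext_add Ext_pushpull -Ext_push_dsum !Ext_push_comp.
by congr (Ext_pull (Ext_push _ _) _); rewrite /codiag /oplus_map !bpE.
Qed.

Lemma Ext_push_opp (C : abelian) n (A A' D : C) (a : Mor A A')
    (E : Ext n.+1 D A) : Ext_push a (Ext_opp E) = Ext_opp (Ext_push a E).
Proof. by rewrite /Ext_opp !Ext_push_comp !bpE. Qed.

(** * Injectivity and surjectivity of the comparison map *)

Section Bijectivity.
Context (C : abelian) (hC : Ab4star C) (n : nat) (I : small) (A : I -> C).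
Context (P : C) (pi : forall i, Mor P (A i)) (hP : is_product pi) (B : C).

Lemma Ext_to_prod_inj : injective (Ext_to_prod n pi B).
Proof.
move=> E E' e; have [c cE] := clP E; have [c' cE'] := clP E'; subst E E'.
(* Cospans give a single [y i] above both sequences for each [i], so one choice over [I] suffices,
   with no zigzag length to bound. *)
have ex i : exists y : exseq n.+1 B (A i),
    ladder (pi i) (idm B) c y /\ ladder (pi i) (idm B) c' y.
  have : cl (exseq_push (pi i) c) = cl (exseq_push (pi i) c').
    by rewrite -!Ext_pushE; exact: (congr1 (fun f => f i) e).
  case/cl_eqP/exseq_equivP => y [cy cy']; exists y; split.
    by have := ladder_comp (ladder_push _ (exseqP c)) cy; rewrite !mcomp1m.
  by have := ladder_comp (ladder_push _ (exseqP c')) cy'; rewrite !mcomp1m.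
pose y i := projT1 (cid (ex i)).
have yP i : ladder (pi i) (idm B) c (y i) /\ ladder (pi i) (idm B) c' (y i).
  exact: projT2 (cid (ex i)).
have [Q [rho hQ]] := proj1 hC I (fun=> B).
have [p [_ pU _]] := product_exseq hC y hP hQ.
(* [dl] is the diagonal of [B] into its power [Q]. *)
have [dl [dlE _]] := hQ B (fun=> idm B).
have le (d : exseq n.+1 B P) : (forall i, ladder (pi i) (idm B) d (y i)) ->
    cl d = cl (exseq_pull dl p).
  move=> L; apply/cl_ladder/(pull_lift (exseqP d) (exseqP p))/pU => i.
  by rewrite mcompm1 dlE.
by rewrite (le c) ?(le c') // => i; case: (yP i).
Qed.

Lemma Ext_to_prod_surj (x : dprod (fun i => Ext n.+1 B (A i))) :
  exists E, Ext_to_prod n pi B E = x.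
Proof.
pose c i := Ext_repr (x i).
have [Q [rho hQ]] := proj1 hC I (fun=> B).
have [p [pL _ _]] := product_exseq hC c hP hQ.
have [dl [dlE _]] := hQ B (fun=> idm B).
exists (cl (exseq_pull dl p)); apply: dprod_ext => i.
(* The right side is written as a pullback along the identity, which is [rho i ∘ dl], so that
   [push_pull] applies to the ladder over [pi i]. *)
rewrite /Ext_to_prod -[RHS]Ext_reprK -[RHS]Ext_pull1; apply: push_pull.
have := ladder_comp (ladder_pull dl (exseqP p)) (pL i).
by rewrite mcompm1 dlE.
Qed.

End Bijectivity.

Theorem theorem3p13 (C : abelian) (hC : Ab4star C) (n : nat)
    (I : small) (A : I -> C) (P : C) (pi : forall i, Mor P (A i))
    (hP : is_product pi) (B : C) :
  zmod_morphism (Ext_to_prod n pi B) /\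
  bijective (Ext_to_prod n pi B).
Proof.
split=> [E E'|].
  apply: dprod_ext => i.
  (* [zmod_morphism] asks for compatibility with subtraction, which is here spelled out as [Ext_add]
     with [Ext_opp]. *)
  transitivity (Ext_add (Ext_push (pi i) E) (Ext_push (pi i) (Ext_opp E'))).
    exact: Ext_push_add.
  by rewrite Ext_push_opp.
pose g x := projT1 (cid (@Ext_to_prod_surj _ hC n _ _ _ _ hP B x)).
have gK : cancel g (Ext_to_prod n pi B).
  by move=> x; rewrite /g; case: cid.
by exists g => // E; apply: (Ext_to_prod_inj hC hP); rewrite gK.
Qed.
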